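(* Let $L=\sum_{P} q^{\text{area of }P}$, where the sum runs over all level three cheesy polyominoes $P$ (on the hexagonal tiling, counted up to translation). Then, as a formal power series in $q$, $L=\dfrac{M}{N}$, where $$\begin{aligned} M ={}& q \cdot (1-11q+49q^{2}-114q^{3}+146q^{4}-94q^{5}+5q^{6}+71q^{7}-143q^{8}\\ &+176q^{9}-154q^{10}+100q^{11}+24q^{12}-121q^{13}+90q^{14}-61q^{15}+19q^{16}\\ &+58q^{17}-32q^{18}-31q^{19}+37q^{20}+14q^{21}-43q^{22}-4q^{23}+21q^{24}\\ &-q^{25}-5q^{26}) \end{aligned}$$ and $$\begin{aligned} N ={}& 1-14q+80q^{2}-243q^{3}+423q^{4}-413q^{5}+174q^{6}+106q^{7}-350q^{8}\\ &+533q^{9}-546q^{10}+427q^{11}-148q^{12}-261q^{13}+383q^{14}-253q^{15}\\ &+158q^{16}+57q^{17}-181q^{18}+10q^{19}+115q^{20}-49q^{21}-96q^{22}\\ &+93q^{23}+49q^{24}-54q^{25}-12q^{26}+12q^{27}+q^{28}. \end{aligned}$$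
   Context: Consider the regular hexagonal tiling of the Euclidean plane, oriented so that every hexagonal tile has two horizontal edges; tiles are called cells. A (hexagonal-celled) polyomino is a union of finitely many (at least one) cells whose interior is connected (for unions of hexagonal cells, this is equivalent to the union being connected). Two polyominoes are considered equal if and only if one is the image of the other under a translation. The area of a polyomino is its number of cells. The cells of a polyomino $P$ are partitioned according to their horizontal projection (cells with the same projection onto the horizontal axis lie in the same block); each block is a column of $P$. Cells of the tiling with the same horizontal projection are stacked vertically, consecutive ones sharing a horizontal edge. A column need not be a connected set; its connected components are its maximal runs of vertically consecutive cells. If a column has two connected components, the gap (hole) between them is the set of cells of the tiling lying in that vertical stack strictly between the two components. Columns are ordered from left to right; the first column is the leftmost one, and two columns are adjacent if they are consecutive in this order. A polyomino $P$ is rightward-semi-directed if the first (leftmost) column of $P$ has no gap (i.e. is connected) and, in every pair of adjacent columns of $P$, every connected component of the right column has at least one edge in common with the left column. For an integer $m\ge 1$, a polyomino $P$ is a level $m$ cheesy polyomino if: (i) $P$ is rightward-semi-directed; (ii) every column of $P$ has at most two connected components; (iii) if a column of $P$ has two connected components, then the gap between the components consists of at most $m$ cells. *)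

(* Defs.v *)
From HB Require Import structures.
From mathcomp Require Import all_boot all_order all_algebra finmap.
From mathcomp Require Import boolp classical_sets cardinality.

Set Implicit Arguments.
Unset Strict Implicit.
Unset Printing Implicit Defensive.
Import Order.TTheory GRing.Theory Num.Theory.
Local Open Scope fset_scope.
Local Open Scope classical_set_scope.
Local Open Scope ring_scope.

(* The pair (x, y) stands for the hexagon of the tiling centred at
   x (3/2, sqrt 3/2) + y (0, sqrt 3), for hexagons of side 1 with two
   horizontal edges.  Hence c.1 determines the horizontal projection of c,
   cells with the same c.1 are stacked vertically in the order of c.2, and the
   translations preserving the tiling are those by vectors of int * int. *)
Notation cell := (int * int)%type.

(* The cells having an edge in common with c are the six cells whose centres
   are at distance sqrt 3 from that of c. *)
Definition adjacent (c d : cell) : bool :=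
  d - c \in [:: (0, 1); (0, -1); (1, 0); (-1, 0); (1, -1); (-1, 1)].

Definition adjacent_in (S : {fset cell}) : rel S :=
  fun u v => adjacent (val u) (val v).

(* Two hexagons of the tiling meet in a common edge or not at all, so the
   topological components of a union of cells correspond to the components of
   the adjacency graph. *)
Definition component (S : {fset cell}) (u : S) : {fset cell} :=
  [fset val v | v in connect (@adjacent_in S) u].

Definition components (S : {fset cell}) : {fset {fset cell}} :=
  [fset component u | u in {: S}].

Definition is_connected (S : {fset cell}) : bool :=
  [forall u : S, forall v : S, connect (@adjacent_in S) u v].

Definition is_polyomino (P : {fset cell}) : Prop :=
  P != fset0 /\ is_connected P.

(* The part of P lying in the vertical stack of abscissa x; it is a column of
   P when it is nonempty. *)
Definition column (P : {fset cell}) (x : int) : {fset cell} :=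
  [fset c in P | c.1 == x].

Definition first_column (P : {fset cell}) (x : int) : Prop :=
  column P x != fset0 /\ forall z, z < x -> column P z = fset0.

Definition adjacent_columns (P : {fset cell}) (x x' : int) : Prop :=
  [/\ x < x', column P x != fset0, column P x' != fset0 &
      forall z, x < z < x' -> column P z = fset0].

Definition shares_edge (C D : {fset cell}) : Prop :=
  exists c d, [/\ c \in C, d \in D & adjacent c d].

Definition rightward_semi_directed (P : {fset cell}) : Prop :=
  (forall x, first_column P x -> is_connected (column P x)) /\
  (forall x x', adjacent_columns P x x' ->
     forall C, C \in components (column P x') -> shares_edge C (column P x)).

Definition gap (x : int) (C D : {fset cell}) : set cell :=
  [set g | [/\ g.1 = x, forall c, c \in C -> c.2 < g.2 &
               forall d, d \in D -> g.2 < d.2]].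

(* In a column with two components one lies above the other, so that one of
   gap x C D and gap x D C is the hole and the other one is empty. *)
Definition cheesy (m : nat) (P : {fset cell}) : Prop :=
  [/\ is_polyomino P,
      rightward_semi_directed P,
      forall x, (#|` components (column P x)| <= 2)%N &
      forall x C D, C \in components (column P x) ->
        D \in components (column P x) -> C != D -> (gap x C D #<= `I_m)%card].

Definition translate (v : cell) (P : {fset cell}) : {fset cell} :=
  [fset c + v | c in P].

Definition translation_class (P : {fset cell}) : set {fset cell} :=
  [set translate v P | v in [set: cell]].

Definition cheesy_classes (m n : nat) : set (set {fset cell}) :=
  [set translation_class P | P in [set P | cheesy m P /\ #|` P| = n]].

(* Formal power series in q over the integers, given by their coefficients.
   As cheesy3_den has constant term 1, it is invertible and L = M / N means
   fps_mul N L = M. *)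
Definition fps := nat -> int.

Definition fps_of_poly (p : {poly int}) : fps := fun n => p`_n.

Definition fps_mul (f g : fps) : fps :=
  fun n => \sum_(i < n.+1) f i * g (n - i)%N.

(* cheesy_classes m n is finite by cheesy_classes_finite below. *)
Definition cheesy_gf (m : nat) : fps :=
  fun n => (#|` fset_set (cheesy_classes m n)|)%:Z.

(* Coefficients are listed in order of increasing degree. *)
Definition cheesy3_num : {poly int} :=
  'X * Poly [:: 1; -11; 49; -114; 146; -94; 5; 71; -143; 176;
           -154; 100; 24; -121; 90; -61; 19; 58; -32; -31;
           37; 14; -43; -4; 21; -1; -5].

Definition cheesy3_den : {poly int} :=
  Poly [:: 1; -14; 80; -243; 423; -413; 174; 106; -350; 533;
           -546; 427; -148; -261; 383; -253; 158; 57; -181; 10;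
           115; -49; -96; 93; 49; -54; -12; 12; 1].

Lemma adjacent_dist (c d : cell) : adjacent c d ->
  `|d.1 - c.1| <= 1 /\ `|d.2 - c.2| <= 1.
Proof.
case: c d => [a b] [a' b']; rewrite /adjacent !inE /=.
by do 5![case/orP; first by case/eqP=> -> ->]; case/eqP=> -> ->.
Qed.

Lemma path_dist (S : {fset cell}) (u : S) (p : seq S) :
  path (@adjacent_in S) u p ->
  `|(val (last u p)).1 - (val u).1| <= (size p)%:Z /\
  `|(val (last u p)).2 - (val u).2| <= (size p)%:Z.
Proof.
elim: p u => [|v p IHp] u /=; first by rewrite !subrr normr0.
case/andP=> /adjacent_dist [uv1 uv2] /IHp [vp1 vp2]; rewrite -addn1 PoszD.
split; [apply: le_trans (ler_distD (val v).1 _ _) _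
       | apply: le_trans (ler_distD (val v).2 _ _) _]; exact: lerD.
Qed.

Lemma uniq_size_card (T : finType) (s : seq T) : uniq s -> (size s <= #|T|)%N.
Proof. by move/card_uniqP <-; apply: max_card. Qed.

Lemma polyomino_dist (P : {fset cell}) (c d : cell) :
  is_polyomino P -> c \in P -> d \in P ->
  `|d.1 - c.1| <= #|` P|%:Z /\ `|d.2 - c.2| <= #|` P|%:Z.
Proof.
case=> _ connP cP dP; have /forallP/(_ [` cP])/forallP/(_ [` dP]) := connP.
case/connectP=> p p_path.
have [q q_path q_uniq _] := shortenP p_path => d_last.
have szq : (size q)%:Z <= #|` P|%:Z.
  by rewrite lez_nat cardfE; apply: ltnW; apply: uniq_size_card q_uniq.
have [d1 d2] := path_dist q_path.
have -> : d = val (last [` cP] q) by rewrite -d_last.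
by split; [apply: le_trans d1 szq | apply: le_trans d2 szq].
Qed.

Lemma translation_class_translate (v : cell) (P : {fset cell}) :
  translation_class (translate v P) = translation_class P.
Proof.
have trD u w Q : translate u (translate w Q) = translate (w + u) Q.
  apply/fsetP=> c; apply/imfsetP/imfsetP=> /= [[d /imfsetP[e /= eQ ->] ->]|].
    by exists e => //; rewrite addrA.
  by case=> e eQ ->; exists (e + w); rewrite ?addrA //; apply/imfsetP; exists e.
apply/seteqP; split=> Q [u _ <-].
  by exists (v + u); rewrite ?trD.
by exists (u - v); rewrite // trD addrC subrK.
Qed.

Lemma cheesy_classes_finite (m n : nat) : finite_set (cheesy_classes m n).
Proof.
pose f (i : 'I_n.*2.+1) : int := i%:Z - n%:Z.
pose B : {fset cell} := [fset (f ij.1, f ij.2) | ij in {: 'I_n.*2.+1 * 'I_n.*2.+1}].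
apply: (@sub_finite_set _ _ (translation_class @` [set` fpowerset B])); last first.
  exact/finite_image/finite_fset.
move=> _ [P [[polyP _ _ _] cardP] <-].
have [/fset0Pn[c cP] _] := polyP.
exists (translate (- c) P); last exact: translation_class_translate.
rewrite /= fpowersetE; apply/fsubsetP=> _ /imfsetP[d /= dP ->].
have [] := polyomino_dist polyP cP dP; rewrite cardP => dc1 dc2.
have fP (z : int) : `|z| <= n%:Z -> exists i, z = f i.
  rewrite ler_norml => /andP[z1 z2].
  have z_ge0 : 0 <= z + n%:Z by rewrite -lerBlDr sub0r.
  have zlt : (absz (z + n%:Z)%R < n.*2.+1)%N.
    by rewrite ltnS -lez_nat gez0_abs // -addnn PoszD lerD2r.
  by exists (Ordinal zlt); rewrite /f /= gez0_abs // addrK.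
have [[i1 e1] [i2 e2]] := (fP _ dc1, fP _ dc2).
apply/imfsetP; exists (i1, i2) => //=.
by rewrite -e1 -e2; case: (d) (c) => [? ?] [].
Qed.

Lemma cheesy3_den0 : fps_of_poly cheesy3_den 0%N = 1.
Proof. by rewrite /fps_of_poly coef_Poly. Qed.

(* Main.v *)
Require Import Defs.
From mathcomp Require Import all_boot all_order all_algebra.
From mathcomp Require Import finmap boolp classical_sets cardinality.
From mathcomp Require Import zify ring.

(* Up to translation, a level three cheesy polyomino is a sequence of columns,
   each given by its height and its shape (a, g, b): a run of a cells, a gap of
   g cells and a run of b cells, with g = b = 0 for a column without hole.  The
   number of ways to attach a column of shape t to the right of one of shape s
   depends only on s and t, and is a linear combination of finitely many
   functions of s.  Hence the generating function G s of the continuations of a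
   column of shape s, which solves G s = 1 + sum_t placements s t q^|t| G t, is
   an explicit combination of such functions, whose coefficients have the
   common denominator N.  The numerators are given explicitly, and the equation,
   which determines G since q is nilpotent modulo q^(n+1), reduces to finitely
   many polynomial identities. *)

Set Implicit Arguments.
Unset Strict Implicit.
Unset Printing Implicit Defensive.
Import Order.TTheory GRing.Theory Num.Theory.

(** The gap bound 3 is what makes finitely many functions suffice. A run of c cells has c + 1
    neighbouring heights in the preceding column, so it lies unattached inside a gap of g cells in g
    - c ways, none once c > 2. Likewise a - h is affine in a, and h - a vanishes, once a > 2. Only
    run lengths 1 and 2 are thus exceptional, and the equation closes on 13 unknowns: E, F, O 1, O
    2, D 1, D 2, D 3 and H h c for h = 1, 2, 3 and c = 1, 2. The coefficient tables are a solution
    of this linear system scaled by its denominator; the proof only checks them. Since the first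
    column is a single run, the series counting all polyominoes is the sum of q^a G (a, 0, 0), which
    is the unknown E; hence M is the numerator of E. All sums are finite because the computation
    takes place in an arbitrary commutative ring where a power of q vanishes; the quotient of Z[X]
    by a power of X then returns the coefficients. *)

Definition shape := (nat * nat * nat)%type.

Definition shape_area (s : shape) : nat := s.1.1 + s.2.

Definition shapes (N : nat) : seq shape :=
  [seq (a, 0, 0) | a <- iota 1 N] ++
  [seq (p.1, g, p.2) | g <- iota 1 3, p <- [seq (a, b) | a <- iota 1 N, b <- iota 1 N]].

(* Number of ways to attach a column of shape t to the right of one of shape s.
   In the last case a + b + g - h positions touch the hull of s with both runs;
   g - c - (h - b) of them put the lower run of t inside the gap of s, and
   g - d - (h - a) the upper one (with truncated subtractions). *)
Definition placements (s t : shape) : nat :=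
  let: (a, g, b) := s in let: (c, h, d) := t in
  if h == 0 then (if g == 0 then a + c else a + b + g + c - (g - c))
  else if g == 0 then a - h
  else a + b + g - h - (g - c - (h - b)) - (g - d - (h - a)).

(** * The transfer operator *)

Section Transfer.
Local Open Scope ring_scope.
Variables (A : comNzRingType) (q : A) (N : nat).
(** Run lengths range over 1, ..., N + 2, so the exceptional terms 1 and 2 can always be split
    off. *)
Hypothesis qN : q ^+ N.+3 = 0.

Local Notation "\Sigma_ b F" := (\sum_(1 <= b < N.+3) F)
  (at level 34, b name, F at level 41, right associativity).

Lemma big_shapes (F : shape -> A) :
  \sum_(t <- shapes N.+2) F t =
  \Sigma_b F (b, 0%N, 0%N) +
  \sum_(1 <= h < 4) \Sigma_c \Sigma_d F (c, h, d).
Proof.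
rewrite /shapes big_cat big_map /index_iota !subSS !subn0; congr +%R.
rewrite big_allpairs_dep; apply: eq_bigr => h _.
by rewrite big_allpairs_dep.
Qed.

(** Summation by parts: multiplying by 1 - q takes differences of the coefficients. For M = N + 2
    the boundary term vanishes by [qN]. *)
Lemma mul_1Bq_sum M (f : nat -> A) :
  (1 - q) * \sum_(1 <= b < M.+1) f b * q ^+ b =
  f 0%N * q + \sum_(1 <= b < M.+1) (f b - f b.-1) * q ^+ b - f M * q ^+ M.+1.
Proof.
elim: M => [|M IH]; first by rewrite !big_geq //; ring.
by rewrite !(@big_nat_recr _ _ _ M.+1) //= mulrDr IH !exprS; ring.
Qed.

Lemma sum0E : (1 - q) * \Sigma_b q ^+ b = q.
Proof.
have := mul_1Bq_sum N.+2 (fun=> 1); rewrite qN mulr0 subr0 mul1r.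
rewrite (eq_bigr (fun b => q ^+ b)); last by move=> b _; rewrite mul1r.
by move=> ->; rewrite big1 ?addr0 // => b _; rewrite subrr mul0r.
Qed.

Lemma sum1E : (1 - q) * \Sigma_b b%:R * q ^+ b = \Sigma_b q ^+ b.
Proof.
rewrite (mul_1Bq_sum N.+2 (fun b => b%:R)) qN mulr0 subr0 mul0r add0r.
rewrite !big_nat; apply: eq_bigr => -[//|b] _ /=.
by rewrite -natrB ?subSnn ?mul1r.
Qed.

Lemma sum2E : (1 - q) * \Sigma_b b%:R ^+ 2 * q ^+ b =
  2 * \Sigma_b b%:R * q ^+ b - \Sigma_b q ^+ b.
Proof.
rewrite (mul_1Bq_sum N.+2 (fun b => b%:R ^+ 2)) qN mulr0 subr0 expr0n mul0r add0r.
rewrite mulr_sumr -sumrB !big_nat; apply: eq_bigr => -[//|b] _ /=.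
by rewrite -natr1; ring.
Qed.

(** As q is nilpotent, 1 - q is a unit, inverted by the finite geometric series; this allows
    denominators to be cleared. *)
Lemma mul_1Bq_inj k (x y : A) : (1 - q) ^+ k * x = (1 - q) ^+ k * y -> x = y.
Proof.
have inv : (1 + \Sigma_b q ^+ b) * (1 - q) = 1.
  by rewrite mulrDl mul1r [X in _ + X]mulrC sum0E subrK.
elim: k => [|k IH]; first by rewrite !expr0 !mul1r.
rewrite exprS -!mulrA => /(congr1 ( *%R (1 + \Sigma_b q ^+ b))).
by rewrite !mulrA inv !mul1r.
Qed.

(** The affine tail is summed over all b >= 1, then the values at b = 1 and b = 2 are corrected. *)
Lemma sum_linear_tail (f : nat -> A) (x y : A) :
  (forall b, (2 < b)%N -> f b = x + b%:R * y) ->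
  (1 - q) ^+ 2 * \Sigma_b q ^+ b * f b =
  (1 - q) * q * x + q * y +
  (1 - q) ^+ 2 * (q * (f 1%N - x - y) + q ^+ 2 * (f 2%N - x - 2 * y)).
Proof.
move=> fE.
have -> : \Sigma_b q ^+ b * f b = (\Sigma_b q ^+ b) * x + (\Sigma_b b%:R * q ^+ b) * y
   + (q * (f 1%N - x - y) + q ^+ 2 * (f 2%N - x - 2 * y)).
  rewrite !mulr_suml -big_split /=.
  rewrite big_ltn // [in RHS]big_ltn // big_ltn // [in RHS]big_ltn //.
  rewrite (@eq_big_nat _ _ _ 3 _ _ (fun b => q ^+ b * x + b%:R * q ^+ b * y)).
    by rewrite !expr1; ring.
  by move=> b /andP[b2 _]; rewrite fE //; ring.
transitivity ((1 - q) * ((1 - q) * \Sigma_b q ^+ b) * x +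
   (1 - q) * ((1 - q) * \Sigma_b b%:R * q ^+ b) * y +
   (1 - q) ^+ 2 * (q * (f 1%N - x - y) + q ^+ 2 * (f 2%N - x - 2 * y))); first by ring.
by rewrite sum1E !sum0E.
Qed.

Lemma sum_mul_linear_tail (f : nat -> A) (x y : A) :
  (forall b, (2 < b)%N -> f b = x + b%:R * y) ->
  (1 - q) ^+ 3 * \Sigma_b b%:R * (q ^+ b * f b) =
  (1 - q) * q * x + q * (1 + q) * y +
  (1 - q) ^+ 3 * (q * (f 1%N - x - y) + 2 * q ^+ 2 * (f 2%N - x - 2 * y)).
Proof.
move=> fE.
have -> : \Sigma_b b%:R * (q ^+ b * f b) =
   (\Sigma_b b%:R * q ^+ b) * x + (\Sigma_b b%:R ^+ 2 * q ^+ b) * y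
   + (q * (f 1%N - x - y) + 2 * q ^+ 2 * (f 2%N - x - 2 * y)).
  rewrite !mulr_suml -big_split /=.
  rewrite big_ltn // [in RHS]big_ltn // big_ltn // [in RHS]big_ltn //.
  rewrite (@eq_big_nat _ _ _ 3 _ _ (fun b => b%:R * q ^+ b * x + b%:R ^+ 2 * q ^+ b * y)).
    by rewrite !expr1; ring.
  by move=> b /andP[b2 _]; rewrite fE //; ring.
transitivity ((1 - q) * ((1 - q) * ((1 - q) * \Sigma_b b%:R * q ^+ b)) * x +
   (1 - q) * ((1 - q) * ((1 - q) * \Sigma_b b%:R ^+ 2 * q ^+ b)) * y +
   (1 - q) ^+ 3 * (q * (f 1%N - x - y) + 2 * q ^+ 2 * (f 2%N - x - 2 * y))); first by ring.
rewrite sum2E mulrBr (mulrCA (1 - q) 2) sum1E sum0E mulrBr (mulrCA (1 - q) 2) !sum0E.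
by ring.
Qed.

Section Kernel.
Variable psi : shape -> A.
Hypothesis psi_sym : forall a g b, (0 < g)%N -> psi (a, g, b) = psi (b, g, a).

Let E := \Sigma_b q ^+ b * psi (b, 0%N, 0%N).
Let F := \Sigma_b b%:R * (q ^+ b * psi (b, 0%N, 0%N)).
Let O c := q ^+ c * psi (c, 0%N, 0%N).
Let D h := \Sigma_c \Sigma_d q ^+ (c + d) * psi (c, h, d).
Let H h c := \Sigma_d q ^+ (c + d) * psi (c, h, d).

Definition transfer (s : shape) : A :=
  \sum_(t <- shapes N.+2) (placements s t)%:R * (q ^+ shape_area t * psi t).

Lemma transfer_one (a : nat) :
  transfer (a, 0%N, 0%N) =
  a%:R * E + F + \sum_(1 <= h < 4) (a - h)%:R * D h.
Proof.
rewrite /transfer big_shapes; congr +%R.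
  rewrite /E /F mulr_sumr -big_split /=; apply: eq_bigr => b _.
  by rewrite /shape_area /= addn0 natrD; ring.
rewrite !big_nat; apply: eq_bigr => -[//|h] _.
by rewrite mulr_sumr; apply: eq_bigr => c _; rewrite mulr_sumr.
Qed.

Lemma sum_truncated g (f : nat -> A) : (g <= 3)%N ->
  \Sigma_c (g - c)%:R * f c = (g - 1)%:R * f 1%N + (g - 2)%:R * f 2%N.
Proof.
move=> g3; rewrite big_ltn // big_ltn // big_nat big1 ?addr0 // => c /andP[c3 _].
by rewrite (_ : (g - c)%N = 0%N) ?mul0r //; lia.
Qed.

(** Positions meeting the hull of s are counted by moments; the corrections, for a run of t inside
    the gap of s, involve only runs of 1 or 2 cells. *)
Lemma transfer_two a g b : (0 < a)%N -> (0 < b)%N -> (0 < g <= 3)%N ->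
  transfer (a, g, b) =
  (a + b + g)%:R * E + F - (g - 1)%:R * O 1 - (g - 2)%:R * O 2 +
  \sum_(1 <= h < 4) ((a + b + g)%:R * D h - h%:R * D h
    - ((g - 1 - (h - b))%:R * H h 1 + (g - 2 - (h - b))%:R * H h 2)
    - ((g - 1 - (h - a))%:R * H h 1 + (g - 2 - (h - a))%:R * H h 2)).
Proof.
move=> a0 b0 /andP[g0 g3]; rewrite /transfer big_shapes; congr +%R.
  rewrite -addrA -opprD -(@sum_truncated g O) // /E /F mulr_sumr -big_split /= -sumrB.
  rewrite !big_nat; apply: eq_bigr => c /andP[c0 _].
  rewrite /shape_area /O /= addn0 eqn0Ngt g0 /= natrB ?natrD; last by lia.
  by ring.
rewrite !big_nat; apply: eq_bigr => h /andP[h0 h3].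
(* The two-term corrections are expanded back into double sums, to be compared with [placements]
   term by term. *)
have HE x : (g - 1 - (h - x))%:R * H h 1 + (g - 2 - (h - x))%:R * H h 2
    = \Sigma_c \Sigma_d (g - (h - x) - c)%:R * (q ^+ (c + d) * psi (c, h, d)).
  rewrite 2!(subnAC g _ (h - x)%N) -(@sum_truncated _ (H h)); last by lia.
  by apply: eq_bigr => c _; rewrite mulr_sumr.
(* Exchanging the sums in the correction with h - a, together with [psi_sym], turns it into the
   correction for the upper run d. *)
rewrite !HE [X in _ - X]exchange_big /= /D !mulr_sumr -!sumrB.
rewrite !big_nat; apply: eq_bigr => c /andP[c0 _].
rewrite !mulr_sumr -!sumrB !big_nat; apply: eq_bigr => d /andP[d0 _].
rewrite (psi_sym d c h0) (addnC d) /shape_area /= !eqn0Ngt g0 h0 /=.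
rewrite -!mulrBl; congr *%R.
rewrite (subnAC g _ c) (subnAC g _ d).
by do 3![rewrite natrB; last by lia].
Qed.

End Kernel.
End Transfer.

(** * Closing conditions for the parameters of the ansatz *)

Section Ansatz.
Local Open Scope ring_scope.
Variables (A : comNzRingType) (q : A) (N : nat).
Hypothesis qN : q ^+ N.+3 = 0.

Local Notation "\Sigma_ b F" := (\sum_(1 <= b < N.+3) F)
  (at level 34, b name, F at level 41, right associativity).

Variables (C E F : A) (O D : nat -> A) (H : nat -> nat -> A).

(* Values of C + transfer psi on a function psi for which E = sum_b q^b psi (b, 0, 0),
   F = sum_b b q^b psi (b, 0, 0), O c = q^c psi (c, 0, 0),
   H h c = sum_d q^(c + d) psi (c, h, d) and D h = sum_c H h c. *)
Definition ansatz (s : shape) : A :=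
  let: (a, g, b) := s in
  C + if g == 0%N then a%:R * E + F + \sum_(1 <= h < 4) (a - h)%:R * D h
  else (a + b + g)%:R * E + F - (g - 1)%:R * O 1 - (g - 2)%:R * O 2 +
    \sum_(1 <= h < 4) ((a + b + g)%:R * D h - h%:R * D h
      - ((g - 1 - (h - b))%:R * H h 1 + (g - 2 - (h - b))%:R * H h 2)
      - ((g - 1 - (h - a))%:R * H h 1 + (g - 2 - (h - a))%:R * H h 2)).

Arguments ansatz _ : simpl never.

Lemma ansatz_sym a g b : (0 < g)%N -> ansatz (a, g, b) = ansatz (b, g, a).
Proof.
case: g => // g _; rewrite /ansatz (addnC b a); congr (_ + (_ + _)).
by apply: eq_bigr => h _; rewrite addrAC.
Qed.

(** Slope in a run length beyond 2: one more cell gives every attached shape exactly one more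
    position. *)
Let y : A := E + (D 1 + D 2 + D 3).

Lemma big_1_4 (f : nat -> A) : \sum_(1 <= h < 4) f h = f 1%N + f 2%N + f 3%N.
Proof. by rewrite unlock /= addr0 addrA. Qed.

Lemma ansatz_one_tail a : (2 < a)%N ->
  ansatz (a, 0%N, 0%N) = ansatz (3%N, 0%N, 0%N) - 3 * y + a%:R * y.
Proof.
case: a => [|[|[|a]]] // _; rewrite /ansatz /= !big_1_4 /y !subSS !subn0.
rewrite -!natr1; ring.
Qed.

Lemma ansatz_two_tail a g b : (0 < g)%N -> (2 < b)%N ->
  ansatz (a, g, b) = ansatz (a, g, 3%N) - 3 * y + b%:R * y.
Proof.
case: g => // g _ b2; rewrite /ansatz !big_1_4 /y.
have -> : (1 - b = 1 - 3)%N by lia.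
have -> : (2 - b = 2 - 3)%N by lia.
have -> : (3 - b = 3 - 3)%N by lia.
rewrite !natrD /=.
by ring.
Qed.

(* (1 - q) ^ 2 times the sum of q ^ b f b, where f b = f 3 + (b - 3) y for b > 2
   and head = q f 1 + q ^ 2 f 2. *)
Definition head_tail_sum (head f3 y : A) : A :=
  let x := f3 - 3 * y in
  (1 - q) * q * x + q * y +
  (1 - q) ^+ 2 * (head - q * (x + y) - q ^+ 2 * (x + 2 * y)).

Definition tail_sum (f1 f2 : A) : A -> A -> A :=
  head_tail_sum (q * f1 + q ^+ 2 * f2).

Definition tail_moment (f1 f2 f3 y : A) : A :=
  (1 - q) * q * (f3 - 3 * y) + q * (1 + q) * y +
  (1 - q) ^+ 3 *
    (q * (f1 - (f3 - 3 * y) - y) + 2 * q ^+ 2 * (f2 - (f3 - 3 * y) - 2 * y)).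

Let row_value a g : A :=
  tail_sum (ansatz (a, g, 1%N)) (ansatz (a, g, 2%N)) (ansatz (a, g, 3%N)) y.

(** The hypotheses [E_sol] to [H_sol] say that the parameters are the sums they stand for, with
    affine tails summed and powers of 1 - q cleared. They are identities whose size does not depend
    on N. *)
Hypothesis E_sol : (1 - q) ^+ 2 * E =
  tail_sum (ansatz (1%N, 0%N, 0%N)) (ansatz (2%N, 0%N, 0%N)) (ansatz (3%N, 0%N, 0%N)) y.
Hypothesis F_sol : (1 - q) ^+ 3 * F =
  tail_moment (ansatz (1%N, 0%N, 0%N)) (ansatz (2%N, 0%N, 0%N)) (ansatz (3%N, 0%N, 0%N)) y.
Hypothesis O_sol : forall c, (0 < c < 3)%N -> O c = q ^+ c * ansatz (c, 0%N, 0%N).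
(* D h sums the rows q ^+ c * row_value c h; its terms c = 1, 2 are H h 1 and H h 2. *)
Hypothesis D_sol : forall h, (0 < h < 4)%N -> (1 - q) ^+ 4 * D h =
  head_tail_sum ((1 - q) ^+ 2 * (H h 1 + H h 2)) (row_value 3 h) ((1 - q) * (q * y)).
Hypothesis H_sol : forall h c, (0 < h < 4)%N -> (0 < c < 3)%N ->
  (1 - q) ^+ 2 * H h c = q ^+ c * row_value c h.

Let row a g := \Sigma_d q ^+ d * ansatz (a, g, d).

Lemma row_sum a g : (0 < g)%N -> (1 - q) ^+ 2 * row a g = row_value a g.
Proof.
move=> g0; rewrite (sum_linear_tail qN (fun b => @ansatz_two_tail a g b g0)).
by rewrite /row_value /tail_sum /head_tail_sum; ring.
Qed.

(** By symmetry, row sums are affine in the other run length too, with slope q y / (1 - q); scaled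
    by (1 - q)^2, this is the slope in [D_sol]. *)
Lemma row_tail a g : (0 < g)%N -> (2 < a)%N ->
  row a g = row 3 g - 3 * (y * \Sigma_d q ^+ d) + a%:R * (y * \Sigma_d q ^+ d).
Proof.
move=> g0 a2; rewrite /row !mulr_sumr -sumrB -big_split /=.
apply: eq_bigr => d _.
rewrite (ansatz_sym a d g0) (ansatz_two_tail d g0 a2) (ansatz_sym 3 d g0).
by ring.
Qed.

Lemma E_sum : E = \Sigma_b q ^+ b * ansatz (b, 0%N, 0%N).
Proof.
apply: (mul_1Bq_inj qN (k := 2)); rewrite E_sol.
rewrite (sum_linear_tail qN ansatz_one_tail).
by rewrite /tail_sum /head_tail_sum; ring.
Qed.

Lemma F_sum : F = \Sigma_b b%:R * (q ^+ b * ansatz (b, 0%N, 0%N)).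
Proof.
apply: (mul_1Bq_inj qN (k := 3)); rewrite F_sol.
by rewrite (sum_mul_linear_tail qN ansatz_one_tail).
Qed.

Lemma H_sum h c : (0 < h < 4)%N -> (0 < c < 3)%N ->
  H h c = \Sigma_d q ^+ (c + d) * ansatz (c, h, d).
Proof.
move=> h4 c3; apply: (mul_1Bq_inj qN (k := 2)); rewrite H_sol //.
case/andP: h4 => h0 _; rewrite -row_sum // /row mulrCA; congr *%R.
by rewrite mulr_sumr; apply: eq_bigr => d _; rewrite mulrA exprD.
Qed.

Lemma D_sum h : (0 < h < 4)%N ->
  D h = \Sigma_c \Sigma_d q ^+ (c + d) * ansatz (c, h, d).
Proof.
move=> h4; apply: (mul_1Bq_inj qN (k := 4)); rewrite D_sol //.
have h0 := proj1 (andP h4); have rowE := row_sum _ h0.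
have -> : \Sigma_c \Sigma_d q ^+ (c + d) * ansatz (c, h, d) = \Sigma_c q ^+ c * row c h.
  apply: eq_bigr => c _; rewrite mulr_sumr; apply: eq_bigr => d _.
  by rewrite mulrA exprD.
rewrite (mulrDr _ (H h 1)) !H_sol // -!rowE (exprD _ 2 2) -[RHS]mulrA.
rewrite (@sum_linear_tail _ _ _ qN (row^~ h) _ _ (fun a => @row_tail a h h0)).
have := sum0E qN; set s := \Sigma_b _ => sE.
rewrite (_ : (1 - q) * (q * y) = (1 - q) * ((1 - q) * s * y)); last by rewrite sE.
by rewrite /head_tail_sum; ring.
Qed.

Lemma ansatz_fixed s : s \in shapes N.+2 -> ansatz s = C + transfer q N ansatz s.
Proof.
rewrite mem_cat => /orP[/mapP[a _ ->]|/allpairsPdep[g [p [g4 p_in ->]]]].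
  rewrite transfer_one -E_sum -F_sum; congr (_ + (_ + _)).
  by rewrite !big_nat; apply: eq_bigr => h h4; rewrite -D_sum.
case/allpairsPdep: p_in g4 => a [b [a_in b_in ->]].
move: a_in b_in; rewrite !mem_iota => /andP[a0 _] /andP[b0 _] g4.
have g3 : (0 < g <= 3)%N by lia.
rewrite (transfer_two q N ansatz_sym) // -E_sum -F_sum -!O_sol //.
rewrite [LHS]/ansatz eqn0Ngt (andP g3).1.
congr (_ + (_ + _)); rewrite !big_nat; apply: eq_bigr => h h4.
by rewrite -D_sum // -!H_sum.
Qed.

End Ansatz.

(** * Its explicit fixed point *)

Section Solution.
Local Open Scope ring_scope.

(* Numerators over the denominator N of the parameters E, F, O, D and H of the
   ansatz for the generating function of the continuations of a column. *)
Definition den_coefs : seq int :=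
  [:: 1; -14; 80; -243; 423; -413; 174; 106; -350; 533; -546; 427; -148; -261;
      383; -253; 158; 57; -181; 10; 115; -49; -96; 93; 49; -54; -12; 12; 1].

Definition num_coefs : seq int :=
  [:: 0; 1; -11; 49; -114; 146; -94; 5; 71; -143; 176; -154; 100; 24; -121;
      90; -61; 19; 58; -32; -31; 37; 14; -43; -4; 21; -1; -5].

Definition moment_coefs : seq int :=
  [:: 0; 1; -10; 40; -82; 90; -47; -8; 62; -110; 121; -106; 46; 58; -86; 61;
      -53; -4; 37; 2; -17; 7; 21; -27; -16; 17; 6; -3; -1].

(** In this table and the next two, for O, D and H, a catch-all branch stands for the largest index
    in use: 2 for O, 3 for D, h = 3 and c = 2 for H. *)
Definition single_coefs (h : nat) : seq int :=
  match h with
  | 1 =>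
      [:: 0; 1; -12; 59; -154; 227; -177; 33; 103; -217; 280; -249; 167; -2;
          -179; 176; -102; 44; 72; -86; -20; 67; -5; -61; 23; 29; -16; -7;
          4]
  | _ =>
      [:: 0; 0; 1; -11; 49; -113; 138; -67; -46; 131; -187; 186; -120; 26;
          106; -178; 112; -45; -15; 84; -48; -27; 36; 20; -49; -5; 29; -3;
          -8; 2]
  end.

Definition double_coefs (h : nat) : seq int :=
  match h with
  | 1 =>
      [:: 0; 0; 1; -8; 25; -36; 15; 23; -41; 49; -47; 13; 8; -23; 57; -33;
          2; -7; -20; 25; 0; -12; -2; 15; 4; -8; 0; 3]
  | 2 =>
      [:: 0; 0; 1; -8; 27; -50; 55; -33; -5; 40; -50; 45; -45; 21; 9; -6;
          16; -20; 0; -7; 3; -4; 15; 12; -11; -7; 3; 1]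
  | _ =>
      [:: 0; 0; 1; -8; 26; -43; 39; -21; -1; 30; -45; 45; -41; 19; -4; 1; 7;
          -13; 19; -6; 4; -7; -14; 7; 6; -2; -1]
  end.

Definition lower_coefs (h c : nat) : seq int :=
  match h, c with
  | 1, 1 =>
      [:: 0; 0; 1; -9; 32; -55; 39; 14; -57; 83; -91; 53; 0; -48; 92; -71;
          20; 1; -30; 37; -3; -17; -2; 22; -3; -14; 5; 4; -2]
  | 1, _ =>
      [:: 0; 0; 0; 1; -8; 25; -37; 21; 13; -43; 71; -79; 41; 22; -77; 85;
          -37; -5; 28; -39; 7; 24; -10; -19; 19; 7; -13; 1; 4; -1]
  | 2, 1 =>
      [:: 0; 0; 1; -9; 34; -70; 86; -64; 16; 44; -87; 85; -60; 29; 2; -8; 7;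
          -10; 2; -7; 19; -14; 4; 4; -6; 1; 2; -1]
  | 2, _ =>
      [:: 0; 0; 0; 1; -8; 26; -44; 42; -21; -12; 54; -69; 35; 11; -36; 19;
          21; -25; 18; -13; -33; 48; 2; -23; 5; 4; -2]
  | _, 1 =>
      [:: 0; 0; 1; -9; 33; -61; 56; -17; -16; 42; -63; 46; -17; 14; -9; 2;
          -11; 9; 6; -14; 21; -14; -8; 11; -1; -2; 1]
  | _, _ =>
      [:: 0; 0; 0; 1; -8; 24; -28; -6; 43; -39; 32; -28; -17; 50; -32; 9; 7;
          -22; 37; -19; -34; 32; 11; -14; -1; 2]
  end.

(** Arithmetic on coefficient lists, constant term first, lets [vm_compute] decide the closing
    identities. *)
Fixpoint padd (l1 l2 : seq int) : seq int :=
  match l1, l2 with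
  | [::], _ => l2
  | _, [::] => l1
  | x :: s, y :: t => x + y :: padd s t
  end.

Definition pscale (c : int) (l : seq int) : seq int := [seq c * x | x <- l].

Definition psub (l1 l2 : seq int) : seq int := padd l1 (pscale (-1) l2).

Definition pmul1Bq (l : seq int) : seq int := psub l (0 :: l).

Definition plin (cs : seq (int * seq int)) : seq int :=
  foldr (fun p => padd (pscale p.1 p.2)) [::] cs.

Definition head_tail_coefs (head f3 y : seq int) : seq int :=
  let x := psub f3 (pscale 3 y) in
  padd (padd (pmul1Bq (0 :: x)) (0 :: y))
    (iter 2 pmul1Bq (psub head (padd (0 :: padd x y) [:: 0, 0 & padd x (pscale 2 y)]))).

Definition tail_coefs (f1 f2 : seq int) : seq int -> seq int -> seq int :=
  head_tail_coefs (padd (0 :: f1) [:: 0, 0 & f2]).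

Definition moment_tail_coefs (f1 f2 f3 y : seq int) : seq int :=
  let x := psub f3 (pscale 3 y) in
  padd (padd (pmul1Bq (0 :: x)) (padd (0 :: y) [:: 0, 0 & y]))
    (iter 3 pmul1Bq (padd (0 :: psub (psub f1 x) y)
                          [:: 0, 0 & pscale 2 (psub (psub f2 x) (pscale 2 y))])).

Definition psi_coefs (s : shape) : seq int :=
  let: (a, g, b) := s in
  let D h := double_coefs h in let H h c := lower_coefs h c in
  plin ([:: (1, den_coefs); (1, moment_coefs)] ++
    if g == 0%N then
      (a%:Z, num_coefs) :: [seq ((a - h)%N%:Z, D h) | h <- [:: 1; 2; 3]%N]
    else
      [:: ((a + b + g)%N%:Z, num_coefs);
          (- (g - 1)%N%:Z, single_coefs 1); (- (g - 2)%N%:Z, single_coefs 2)] ++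
      flatten [seq [:: ((a + b + g)%N%:Z - h%:Z, D h);
          (- ((g - 1 - (h - b)) + (g - 1 - (h - a)))%N%:Z, H h 1);
          (- ((g - 2 - (h - b)) + (g - 2 - (h - a)))%N%:Z, H h 2)] | h <- [:: 1; 2; 3]%N]).

Definition slope_coefs : seq int :=
  padd num_coefs (padd (double_coefs 1) (padd (double_coefs 2) (double_coefs 3))).

Variables (A : comNzRingType) (q : A) (N : nat).
Hypothesis qN : q ^+ N.+3 = 0.

Definition ev (l : seq int) : A := foldr (fun c r => c%:~R + q * r) 0 l.

Lemma ev_add l1 l2 : ev (padd l1 l2) = ev l1 + ev l2.
Proof.
elim: l1 l2 => [|x s IH] [|y t] /=; rewrite ?add0r ?addr0 //.
by rewrite IH intrD; ring.
Qed.

Lemma ev_scale c l : ev (pscale c l) = c%:~R * ev l.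
Proof. by elim: l => [|x s IH] /=; rewrite ?mulr0 // IH intrM; ring. Qed.

Lemma ev_sub l1 l2 : ev (psub l1 l2) = ev l1 - ev l2.
Proof. by rewrite ev_add ev_scale mulrN1z mulN1r. Qed.

Lemma ev_shift l : ev (0 :: l) = q * ev l.
Proof. by rewrite /= add0r. Qed.

Lemma ev_mul1Bq l : ev (pmul1Bq l) = (1 - q) * ev l.
Proof. by rewrite ev_sub ev_shift; ring. Qed.

Lemma ev_iter_mul1Bq k l : ev (iter k pmul1Bq l) = (1 - q) ^+ k * ev l.
Proof.
elim: k => [|k IH]; first by rewrite mul1r.
by rewrite iterS ev_mul1Bq IH exprS mulrA.
Qed.

Lemma ev_head_tail head f3 y :
  ev (head_tail_coefs head f3 y) = head_tail_sum q (ev head) (ev f3) (ev y).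
Proof.
rewrite /head_tail_coefs /head_tail_sum.
rewrite !(ev_add, ev_iter_mul1Bq, ev_mul1Bq, ev_shift, ev_sub, ev_scale).
by ring.
Qed.

Lemma ev_tail f1 f2 f3 y :
  ev (tail_coefs f1 f2 f3 y) = tail_sum q (ev f1) (ev f2) (ev f3) (ev y).
Proof. by rewrite ev_head_tail ev_add !ev_shift mulrA. Qed.

Lemma ev_moment_tail f1 f2 f3 y :
  ev (moment_tail_coefs f1 f2 f3 y) = tail_moment q (ev f1) (ev f2) (ev f3) (ev y).
Proof.
rewrite /moment_tail_coefs /tail_moment.
rewrite !(ev_add, ev_iter_mul1Bq, ev_mul1Bq, ev_shift, ev_sub, ev_scale).
by ring.
Qed.

Lemma ev_lin cs : ev (plin cs) = \sum_(p <- cs) p.1%:~R * ev p.2.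
Proof.
elim: cs => [|p cs IH]; first by rewrite big_nil.
by rewrite big_cons -IH /= ev_add ev_scale.
Qed.

(** Computed lists may differ by trailing zeros, so their difference is tested instead of their
    equality. *)
Lemma ev_eq l1 l2 : all (eq_op 0) (psub l1 l2) -> ev l1 = ev l2.
Proof.
move=> l0; apply/eqP; rewrite -subr_eq0 -ev_sub; apply/eqP.
elim: (psub _ _) l0 => //= x s IH /andP[/eqP<- /IH->].
by rewrite mulr0 addr0.
Qed.

Definition psi : shape -> A :=
  ansatz (ev den_coefs) (ev num_coefs) (ev moment_coefs)
    (fun c => ev (single_coefs c)) (fun h => ev (double_coefs h))
    (fun h c => ev (lower_coefs h c)).

Lemma psiE s : psi s = ev (psi_coefs s).
Proof.
case: s => [[a g] b]; rewrite ev_lin /psi /ansatz !big_1_4.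
(* Generalising the tables keeps simplification from unfolding them; a formal identity in their
   evaluations remains. *)
move: den_coefs num_coefs moment_coefs single_coefs double_coefs lower_coefs.
move=> n e f o d k; case: (g =P 0%N) => _; rewrite /= !big_cons big_nil /=.
  by ring.
by ring.
Qed.

Lemma slopeE :
  ev num_coefs + (ev (double_coefs 1) + ev (double_coefs 2) + ev (double_coefs 3)) =
  ev slope_coefs.
Proof. by rewrite !ev_add !addrA. Qed.

Lemma psi_num : (1 - q) ^+ 2 * ev num_coefs =
  tail_sum q (psi (1, 0, 0)%N) (psi (2, 0, 0)%N) (psi (3, 0, 0)%N) (ev slope_coefs).
Proof.
rewrite !psiE -ev_tail -ev_iter_mul1Bq; apply: ev_eq.
by vm_compute.
Qed.

Lemma sum_psi_one : \sum_(1 <= b < N.+3) q ^+ b * psi (b, 0%N, 0%N) = ev num_coefs.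
Proof. by apply/esym/E_sum => //; rewrite -/psi slopeE psi_num. Qed.

(** This is the equation for G multiplied by the denominator, which replaces the constant term 1. *)
Lemma psi_fixed s : s \in shapes N.+2 -> psi s = ev den_coefs + transfer q N psi s.
Proof.
apply: ansatz_fixed => //; rewrite -/psi ?slopeE.
- exact: psi_num.
- rewrite !psiE -ev_moment_tail -ev_iter_mul1Bq; apply: ev_eq.
  by vm_compute.
- move=> c c3; rewrite psiE.
  have /orP : (c == 1)%N || (c == 2)%N by lia.
  case=> /eqP->.
    by rewrite expr1 -ev_shift; apply: ev_eq; vm_compute.
  by rewrite expr2 -mulrA -!ev_shift; apply: ev_eq; vm_compute.
- move=> h h4; rewrite !psiE -!ev_tail -ev_add -ev_shift -ev_mul1Bq.
  rewrite -!ev_iter_mul1Bq -ev_head_tail; apply: ev_eq.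
  have /or3P : [|| h == 1, h == 2 | h == 3]%N by lia.
  by case=> /eqP->; vm_compute.
- move=> h c h4 c3; rewrite !psiE -ev_tail -ev_iter_mul1Bq.
  have /or3P h123 : [|| h == 1, h == 2 | h == 3]%N by lia.
  have /orP : (c == 1)%N || (c == 2)%N by lia.
  case=> /eqP->.
    by rewrite expr1 -ev_shift; apply: ev_eq; case: h123 => /eqP->; vm_compute.
  by rewrite expr2 -mulrA -!ev_shift; apply: ev_eq; case: h123 => /eqP->; vm_compute.
Qed.

End Solution.

(** * Enumeration of column sequences *)

Section Codes.
Local Open Scope ring_scope.

(* The height of the lowest cell of a column, and its shape. *)
Definition column_code := (int * shape)%type.

Definition valid_shape (s : shape) : bool :=
  let: (a, g, b) := s in
  (0 < a)%N && ((g == 0%N) && (b == 0%N) || (0 < g <= 3)%N && (0 < b)%N).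

(** The c cells from height y upwards have left neighbours at the c + 1 heights y, ..., y + c,
    whence the comparison with z - 1 instead of z. *)
Definition run_touches (p : column_code) (y : int) (c : nat) : bool :=
  let: (z, (a, g, b)) := p in
  (y < z + a%:Z) && (z - 1 < y + c%:Z) ||
  [&& (0 < b)%N, y < z + (a + g + b)%:Z & z + (a + g)%:Z - 1 < y + c%:Z].

Definition touches (p r : column_code) : bool :=
  let: (y, (c, h, d)) := r in
  run_touches p y c && ((d == 0%N) || run_touches p (y + (c + h)%:Z) d).

Definition step (p r : column_code) : bool := touches p r && valid_shape r.2.

(** The window scanned is wide enough to contain every touching height; see [mem_offsets]. *)
Definition offsets (p : column_code) (t : shape) : seq int :=
  let: (z, (a, g, b)) := p in let: (c, h, d) := t in
  [seq y <- [seq z - (c + h + d)%:Z + i%:Z | i <- iota 0 (a + g + b + c + h + d).+1] |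
    touches p (y, t)].

Lemma count_interval M lo hi :
  count (fun i => (lo <= i < hi)%N) (iota 0 M) = (minn hi M - lo)%N.
Proof.
elim: M => [|M IH]; first by rewrite minn0 sub0n.
rewrite -addn1 iotaD count_cat IH /= addn0 add0n.
by case: (leqP lo M) (ltnP M hi) => ? [] ? /=; lia.
Qed.

Lemma count_minus_two (T : eqType) (s : seq T) (P I Q1 Q2 : pred T) :
  {in s, forall x, P x + Q1 x + Q2 x = I x}%N ->
  count P s = (count I s - count Q1 s - count Q2 s)%N.
Proof.
move=> eqs; suff <- : (count P s + count Q1 s + count Q2 s = count I s)%N by rewrite addnAC addnK addnK.
elim: s eqs => //= x s IH eqs.
rewrite -(eqs x) ?mem_head // -IH => [|y ys]; first by ring.
by rewrite eqs // in_cons ys orbT.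
Qed.

(** Positions meeting the hull form an interval, from which those with a run of t inside the gap of
    s are removed. Two runs cannot both be inside: this would need c + h + d < g <= 3 with c, h, d
    positive. *)
Lemma size_offsets p t : valid_shape p.2 -> valid_shape t ->
  size (offsets p t) = placements p.2 t.
Proof.
case: p t => z [[a g] b] [[c h] d] /andP[a0 gb] /andP[c0 hd].
rewrite /offsets size_filter count_map.
(* In terms of i, where y = z - (c + h + d) + i: every run of t meets the hull of s; among these
   positions, its only or lower run lies in the gap of s; its upper run does. *)
rewrite (@count_minus_two _ _ _
  (fun i => if h == 0%N then 0 <= i < a + g + b + c else h + d <= i < a + g + b + d)%N
  (fun i => if h == 0%N then a + c <= i < a + g
            else a + c + h + d <= i < minn (a + g + h + d) (a + b + g + d))%N
  (fun i => if h == 0%N then false else maxn (a + d) (h + d) <= i < a + g)%N).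
  case: (h =P 0%N) => h0.
    rewrite !count_interval count_pred0 /placements h0 /=.
    by case: (g =P 0%N) => g0; lia.
  rewrite !count_interval /placements /= (introF eqP h0).
  have -> : (minn (a + g + b + d) (a + g + b + c + h + d).+1 = a + b + g + d)%N by lia.
  have -> : (minn (minn (a + g + h + d) (a + b + g + d)) (a + g + b + c + h + d).+1
    = minn (a + g + h + d) (a + b + g + d))%N by lia.
  have -> : (minn (a + g) (a + g + b + c + h + d).+1 = a + g)%N by lia.
  have -> : (a + b + g + d - (h + d) = a + b + g - h)%N by lia.
  have -> : (minn (a + g + h + d) (a + b + g + d) - (a + c + h + d) = g - c - (h - b))%N by lia.
  have -> : (a + g - maxn (a + d) (h + d) = g - d - (h - a))%N by lia.
  by case: (g =P 0%N) => g0 //; lia.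
move=> i _ /=.
case: (h =P 0%N) => h0.
  by lia.
by lia.
Qed.

Definition code_area (c : seq column_code) : nat := sumn [seq shape_area r.2 | r <- c].

Definition nexts (M : nat) (p : column_code) : seq column_code :=
  [seq (y, t) | t <- shapes M, y <- offsets p t].

Fixpoint conts (M k : nat) (p : column_code) : seq (seq column_code) :=
  if k is k'.+1 then [::] :: [seq r :: c | r <- nexts M p, c <- conts M k' r]
  else [:: [::]].

Definition bar (a : nat) : column_code := (0, (a, 0%N, 0%N)).

(* The first column of a code is a single run starting at height 0. *)
Definition codes (M : nat) : seq (seq column_code) :=
  [seq bar a :: c | a <- iota 1 M, c <- conts M M.+1 (bar a)].

Definition is_code (c : seq column_code) : bool :=
  if c is p :: c' then [&& (0 < p.2.1.1)%N, p == bar p.2.1.1 & path step p c'] else false.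

Lemma mem_shapes M t : (t \in shapes M) = [&& valid_shape t, (t.1.1 <= M)%N & (t.2 <= M)%N].
Proof.
case: t => [[a g] b]; rewrite mem_cat; apply/orP/idP => [[]|].
- by case/mapP => a'; rewrite mem_iota /= => ? [-> -> ->]; lia.
- case/allpairsPdep => g' [p []]; rewrite mem_iota => g3 /allpairsPdep[a' [b' []]].
  rewrite !mem_iota => /andP[a0 aM] /andP[b0 bM] -> [-> -> ->] /=.
  by rewrite a0 b0 andbT; apply/and3P; split=> //; apply/orP; right.
move=> /and3P[vt aM bM]; rewrite /= in vt aM bM; case: (g =P 0%N) => g0.
  left; apply/mapP; exists a; first by rewrite mem_iota; lia.
  by rewrite g0 (_ : b = 0%N) //; lia.
right; apply/allpairsPdep; exists g, (a, b); rewrite mem_iota; split=> //; first by lia.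
by apply/allpairsPdep; exists a, b; rewrite !mem_iota; split=> //; lia.
Qed.

Lemma shapes_uniq M : uniq (shapes M).
Proof.
rewrite cat_uniq map_inj_uniq ?iota_uniq => [|a a' [] //]; apply/and3P; split=> //.
  apply/hasPn => _ /allpairsPdep[g [p [g3 _ ->]]]; apply/mapP => -[a _ [_ g0 _]].
  by move: g3; rewrite g0.
apply: allpairs_uniq_dep => //.
  move=> g _; apply: allpairs_uniq; rewrite ?iota_uniq //.
  by move=> [? ?] [? ?] _ _ /= [-> ->].
by move=> [g [a b]] [g' [a' b']] _ _ /= [-> -> ->].
Qed.

Lemma mem_offsets p y t : (y \in offsets p t) = touches p (y, t).
Proof.
case: p t => z [[a g] b] [[c h] d]; rewrite mem_filter andb_idr // => tch.
apply/mapP; exists (absz (y - z + (c + h + d)%N%:Z)); last by move: tch => /=; lia.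
by rewrite mem_iota; move: tch => /=; lia.
Qed.

Lemma offsets_uniq p t : uniq (offsets p t).
Proof.
case: p t => z [[a g] b] [[c h] d]; apply: filter_uniq.
by rewrite map_inj_uniq ?iota_uniq // => i j /addrI [].
Qed.

Lemma mem_nexts M p r : (r \in nexts M p) = touches p r && (r.2 \in shapes M).
Proof.
apply/allpairsPdep/andP => [[t [y [tM]]]|[tch rM]].
  by rewrite mem_offsets => tch ->.
by exists r.2, r.1; rewrite mem_offsets -surjective_pairing.
Qed.

Lemma nexts_uniq M p : uniq (nexts M p).
Proof.
apply: allpairs_uniq_dep; first exact: shapes_uniq.
  by move=> t _; apply: offsets_uniq.
by move=> [t y] [t' y'] _ _ /= [-> ->].
Qed.

Lemma mem_conts M k p c : (c \in conts M k p) =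
  [&& (size c <= k)%N, path step p c & all (fun r => r.2 \in shapes M) c].
Proof.
elim: k p c => [|k IH] p [|r c] //=; rewrite in_cons //=.
apply/allpairsPdep/idP => [[r' [c' [rM cM [-> ->]]]]|].
  move: rM cM; rewrite mem_nexts IH => /andP[tch rM] /and3P[szc pc ac].
  by rewrite ltnS szc /step tch pc rM ac; move: rM; rewrite mem_shapes => /andP[->].
case/and3P; rewrite ltnS => szc /andP[/andP[tch _] pc] /andP[rM ac].
by exists r, c; rewrite mem_nexts IH tch rM szc pc ac.
Qed.

Lemma conts_uniq M k p : uniq (conts M k p).
Proof.
elim: k p => //= k IH p; apply/andP; split; first by apply/allpairsPdep => -[? [? [? ? //]]].
apply: allpairs_uniq_dep => [|r _|]; rewrite ?nexts_uniq //.
by move=> [? ?] [? ?] _ _ /= [-> ->].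
Qed.

Arguments conts : simpl never.

Lemma codes_uniq M : uniq (codes M).
Proof.
apply: allpairs_uniq_dep => [|a _|]; rewrite ?iota_uniq ?conts_uniq //.
by move=> [? ?] [? ?] _ _ /= [-> ->].
Qed.

Lemma shape_area_gt0 t : valid_shape t -> (0 < shape_area t)%N.
Proof. by case: t => [[a g] b] /andP[a0 _]; rewrite /shape_area /=; lia. Qed.

Lemma path_step_size p c : path step p c -> (size c <= code_area c)%N.
Proof.
elim: c p => //= r c IH p /andP[/andP[_ vr] /IH]; rewrite /code_area /=.
by move: (shape_area_gt0 vr); lia.
Qed.

Lemma path_step_shapes M p c : path step p c -> (code_area c <= M)%N ->
  all (fun r => r.2 \in shapes M) c.
Proof.
elim: c p => //= r c IH p /andP[/andP[_ vr] pc]; rewrite /code_area /= => cM.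
rewrite (IH _ pc) ?andbT; last by rewrite /code_area; lia.
have rM : (shape_area r.2 <= M)%N by apply: leq_trans cM; apply: leq_addr.
by rewrite mem_shapes vr !(leq_trans _ rM) ?leq_addr ?leq_addl.
Qed.

Lemma mem_codes M c : (code_area c <= M)%N -> (c \in codes M) = is_code c.
Proof.
move=> cM; apply/allpairsPdep/idP => [[a [c' [aM c'M ->]]] | ].
  move: c'M aM; rewrite mem_conts mem_iota => /and3P[_ pc _] /andP[a0 _].
  by rewrite /is_code /= a0 eqxx.
case: c cM => // p c; rewrite /code_area /= => cM /and3P[a0 /eqP pE pc].
exists p.2.1.1, c; rewrite -pE mem_conts mem_iota; split=> //.
  by rewrite a0 add1n ltnS (leq_trans _ cM) // -addnA leq_addr.
rewrite pc (path_step_shapes pc); last by rewrite /code_area; lia.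
rewrite !andbT (leq_trans (path_step_size pc)) // (leq_trans _ (leqnSn M)) //.
by apply: leq_trans cM; apply: leq_addl.
Qed.

End Codes.

(** * The generating function of column sequences *)

Section CodesGF.
Local Open Scope ring_scope.
Variables (A : comNzRingType) (q : A) (N : nat).
Hypothesis qN : q ^+ N.+3 = 0.

Fixpoint conts_gf (k : nat) (s : shape) : A :=
  if k is k'.+1 then 1 + transfer q N (conts_gf k') s else 1.

(** The weight of the continuations depends only on the shape of the next column, so its heights
    contribute only their number. *)
Lemma sum_conts k p : valid_shape p.2 ->
  \sum_(c <- conts N.+2 k p) q ^+ code_area c = conts_gf k p.2.
Proof.
elim: k p => [|k IH] p vp; first by rewrite big_seq1.
rewrite /= big_cons expr0; congr +%R; rewrite big_allpairs_dep /= big_allpairs_dep.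
rewrite /transfer big_seq [RHS]big_seq; apply: eq_bigr => t.
rewrite mem_shapes => /andP[vt _].
rewrite -(size_offsets vp vt) -sum1_size natr_sum mulr_suml.
apply: eq_bigr => y _; rewrite mul1r; have /= <- := IH (y, t) vt; rewrite mulr_sumr.
by apply: eq_bigr => c _; rewrite /code_area /= exprD.
Qed.

(* The error of conts_gf k is divisible by q ^ k, since every column has a cell. *)
Lemma conts_gf_approx k s : s \in shapes N.+2 ->
  exists x, psi q s - ev q den_coefs * conts_gf k s = q ^+ k * x.
Proof.
elim: k s => [|k IH] s sN; first by exists (psi q s - ev q den_coefs * conts_gf 0 s); rewrite mul1r.
rewrite (psi_fixed qN sN) -[conts_gf _ _]/(1 + transfer q N (conts_gf k) s) mulrDr mulr1 opprD addrACA subrr add0r.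
rewrite /transfer mulr_sumr -sumrB big_seq.
apply: (big_ind (fun z => exists x, z = q ^+ k.+1 * x)).
- by exists 0; rewrite mulr0.
- by move=> _ _ [x ->] [y ->]; exists (x + y); rewrite mulrDr.
move=> t tN; have [x xE] := IH t tN.
have : (0 < shape_area t)%N by apply: shape_area_gt0; move: tN; rewrite mem_shapes => /andP[].
case: (shape_area t) => // m _; exists ((placements s t)%:R * q ^+ m * x).
transitivity ((placements s t)%:R * q ^+ m.+1 * (psi q t - ev q den_coefs * conts_gf k t)).
  by ring.
by rewrite xE !exprS; ring.
Qed.

Lemma den_sum_codes :
  ev q den_coefs * \sum_(c <- codes N.+2) q ^+ code_area c = ev q num_coefs.
Proof.
rewrite -(sum_psi_one qN) big_allpairs_dep mulr_sumr /index_iota subSS subn0.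
rewrite big_seq [RHS]big_seq; apply: eq_bigr => a; rewrite mem_iota => /andP[a0 aN].
have aV : (a, 0%N, 0%N) \in shapes N.+2 by rewrite mem_shapes /= a0 -ltnS aN.
(* N + 3 is the depth used by [codes N.+2], and at this depth the error vanishes by [qN]. *)
have [x] := conts_gf_approx N.+3 aV; rewrite qN mul0r => /subr0_eq ->.
rewrite mulrCA; congr *%R; have /= <- := @sum_conts N.+3 (bar a).
  rewrite mulr_sumr; apply: eq_bigr => c _.
  by rewrite -exprD /code_area /= /shape_area /= addn0.
by rewrite /= a0.
Qed.

End CodesGF.

(** * From nilpotent q to coefficients of polynomials *)

Section Coefficients.
Local Open Scope ring_scope.

Lemma in_qpoly_inj (R : comNzRingType) (k : nat) (p r : {poly R}) n : (n < k)%N ->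
  in_qpoly 'X^k p = in_qpoly 'X^k r -> p`_n = r`_n.
Proof.
case: k => // k nk /(congr1 val) /= eqpr.
rewrite mk_monic_Xn /= in eqpr.
have divE := Pdiv.RingMonic.rdivp_eq (monicXn R k.+1).
by rewrite (divE p) (divE r) !coefD !coefMXn nk !add0r eqpr.
Qed.

Lemma in_qpoly_Poly k (l : seq int) :
  in_qpoly 'X^k (Poly l) = ev (in_qpoly 'X^k 'X : {poly %/ 'X^k}) l.
Proof.
elim: l => [|c l IH]; first by rewrite rmorph0.
rewrite /= cons_poly_def rmorphD rmorphM /= IH addrC mulrC; congr +%R.
by rewrite -[c in LHS]intz rmorph_int rmorph_int.
Qed.

(** The hypothesis is applied to the class of X in Z[X]/(X^(n+3)), where coefficients of degree
    below n + 3 are well defined. *)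
Lemma coef_mul_sum_codes n (d e : seq int) :
  (forall (A : comNzRingType) (q : A), q ^+ n.+3 = 0 ->
    ev q d * \sum_(c <- codes n.+2) q ^+ code_area c = ev q e) ->
  (Poly d * \sum_(c <- codes n.+2) 'X^(code_area c))`_n = (Poly e)`_n.
Proof.
move=> de; apply: (@in_qpoly_inj _ n.+3); first by rewrite ltnS leqW.
rewrite rmorphM rmorph_sum /= !in_qpoly_Poly -de.
  by congr (_ * _); apply: eq_bigr => c _; rewrite rmorphXn.
rewrite -rmorphXn; apply: val_inj.
by rewrite /= mk_monic_Xn Pdiv.RingMonic.rmodpp ?monicXn.
Qed.

Lemma coef_den_codes n :
  (cheesy3_den * \sum_(c <- codes n.+2) 'X^(code_area c))`_n = cheesy3_num`_n.
Proof.
have -> : cheesy3_num = Poly num_coefs.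
  by rewrite -[Poly _]/(cons_poly 0 (Poly (behead num_coefs))) cons_poly_def addr0 mulrC.
by apply: coef_mul_sum_codes => A q; apply: den_sum_codes.
Qed.

Lemma coef_sum_Xn (T : Type) (s : seq T) (f : T -> nat) n :
  (\sum_(c <- s) 'X^(f c) : {poly int})`_n = (count (fun c => f c == n) s)%:Z.
Proof.
rewrite coef_sum -natz -sum1_count natr_sum [RHS]big_mkcond /=.
by apply: eq_bigr => c _; rewrite coefXn eq_sym; case: eqP.
Qed.

End Coefficients.

(** * Polyominoes as column sequences *)

Section Connectivity.
Local Open Scope fset_scope.
Local Open Scope ring_scope.

Lemma adjacentE (c d : cell) : adjacent c d =
  [|| (d.1 == c.1) && ((d.2 == c.2 + 1) || (c.2 == d.2 + 1)),
      (d.1 == c.1 + 1) && ((d.2 == c.2) || (c.2 == d.2 + 1)) |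
      (c.1 == d.1 + 1) && ((d.2 == c.2) || (d.2 == c.2 + 1))].
Proof.
case: c d => [a b] [a' b']; rewrite /adjacent -[_ - _]/(a' - a, b' - b).
by rewrite !inE !xpair_eqE /=; lia.
Qed.

Lemma adjacent_sym : symmetric adjacent.
Proof. by move=> c d; rewrite !adjacentE; lia. Qed.

(** A relation on plain cells, so that connections in different sets can be compared. *)
Definition linked (S : {fset cell}) (u v : cell) : Prop :=
  exists (uS : u \in S) (vS : v \in S), connect (@adjacent_in S) [` uS] [` vS].

Lemma linked_refl S u : u \in S -> linked S u u.
Proof. by move=> uS; exists uS, uS; apply: connect0. Qed.

Lemma linked_trans S v u w : linked S u v -> linked S v w -> linked S u w.
Proof.
move=> [uS [vS uv]] [vS' [wS vw]]; exists uS, wS; apply: connect_trans uv _.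
by rewrite (bool_irrelevance vS vS').
Qed.

Lemma linked_sym S u v : linked S u v -> linked S v u.
Proof.
move=> [uS [vS uv]]; exists vS, uS; rewrite sym_connect_sym // => x y.
exact: adjacent_sym.
Qed.

Lemma linked_adjacent (S : {fset cell}) u v :
  u \in S -> v \in S -> adjacent u v -> linked S u v.
Proof. by move=> uS vS uv; exists uS, vS; apply: connect1. Qed.

(** Invariants propagate along paths; this is how cells are shown not to be connected. *)
Lemma linked_closed (S : {fset cell}) (a : pred cell) u v :
  {in S &, forall s t, adjacent s t -> a s -> a t} -> linked S u v -> a u -> a v.
Proof.
move=> aS [uS [vS /connectP[p]]].
elim: p u uS => [|t p IH] u uS /=; first by move=> _ /(congr1 val) /= ->.
case: t => t tS /andP[ut tp] last_p au; apply: (IH t tS) => //.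
exact: aS ut au.
Qed.

Lemma linked_sub (S T : {fset cell}) u v : S `<=` T -> linked S u v -> linked T u v.
Proof.
move=> ST uv; have [uS _] := uv.
pose a w := `[< linked T u w >].
suff : a v by move/asboolP.
apply: (linked_closed (a := a) _ uv); last first.
  by apply/asboolP/linked_refl/(fsubsetP ST).
move=> s t sS tS st /asboolP us; apply/asboolP/(linked_trans us).
by apply: linked_adjacent => //; apply: (fsubsetP ST).
Qed.

Lemma is_connectedP S :
  reflect {in S &, forall u v, linked S u v} (is_connected S).
Proof.
apply: (iffP idP) => [/forallP conS u v uS vS|conS].
  by exists uS, vS; have /forallP := conS [` uS]; apply.
apply/forallP => -[u uS]; apply/forallP => -[v vS].
have [uS' [vS']] := conS u v uS vS.
by rewrite (bool_irrelevance uS uS') (bool_irrelevance vS vS').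
Qed.

Lemma componentsP S C : C \in components S <->
  exists2 u, u \in S & forall v, v \in C <-> linked S u v.
Proof.
have compE (u : S) v : v \in component u <-> linked S (val u) v.
  case: u => u uS; split=> [/imfsetP[[w wS] /= uw ->]|[uS' [vS uv]]].
    by exists uS, wS.
  apply/imfsetP; exists [` vS] => //=.
  by rewrite (bool_irrelevance uS uS').
split=> [/imfsetP[/= u _ ->]|[u uS uC]].
  by exists (val u); [apply: valP | move=> v; apply: compE].
apply/imfsetP; exists [` uS] => //; apply/fsetP => v.
apply/idP/idP => [vC|/(compE [` uS] v)]; last exact: (uC v).2.
by apply/(compE [` uS] v)/uC.
Qed.

(** A missing cell is a barrier: no adjacency within one stack passes over it. *)
Lemma linked_column (S : {fset cell}) x y y' :
  {in S, forall c, c.1 = x} -> y <= y' ->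
  linked S (x, y) (x, y') <-> (forall z, y <= z <= y' -> (x, z) \in S).
Proof.
move=> Sx yy'; split=> [lk z /andP[yz zy']|yS].
  apply: contraT => zS.
  suff : y' < z by rewrite ltNge zy'.
  apply: (linked_closed (a := fun c => c.2 < z) _ lk) => /=; last first.
    have [yS _] := lk; rewrite lt_neqAle yz andbT; apply: contraNneq zS => <-.
    exact: yS.
  move=> [x1 s] [x2 t] sS tS; have /= -> := Sx _ sS; have /= x2x := Sx _ tS.
  have : t != z by apply: contraNneq zS => <-; rewrite -x2x.
  by rewrite adjacentE x2x /=; lia.
have [n y'E] : exists n : nat, y' = y + n%:Z by exists (absz (y' - y)); lia.
move: yS; rewrite {yy'}y'E.
elim: n => [|n IH] yS; first by rewrite addr0; apply/linked_refl/yS; lia.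
apply: linked_trans (IH _) _; first by move=> z yz; apply: yS; lia.
apply: linked_adjacent; try by apply: yS; lia.
by rewrite adjacentE /=; lia.
Qed.

End Connectivity.

(** * Columns as one or two runs *)

Section Columns.
Local Open Scope fset_scope.
Local Open Scope ring_scope.

Definition run (x y : int) (n : nat) : {fset cell} :=
  [fset (x, y + i%:Z) | i in iota 0 n].

Lemma mem_run x y n c : (c \in run x y n) = (c.1 == x) && (y <= c.2 < y + n%:Z).
Proof.
apply/imfsetP/idP => [[i /=]|]; rewrite ?mem_iota.
  by move=> i_n -> /=; lia.
case: c => [x' z] /= /andP[/eqP-> yz]; exists (absz (z - y)).
  by rewrite /= mem_iota; lia.
by congr (_, _); lia.
Qed.

Lemma card_run x y n : #|` run x y n| = n.
Proof.
rewrite card_imfset /=; last by move=> i j [] /addrI [].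
by rewrite undup_id ?size_iota ?iota_uniq.
Qed.

Definition lower (x : int) (p : column_code) := run x p.1 p.2.1.1.
Definition upper (x : int) (p : column_code) :=
  run x (p.1 + (p.2.1.1 + p.2.1.2)%N%:Z) p.2.2.
Definition col (x : int) (p : column_code) := lower x p `|` upper x p.

Lemma mem_lower x p c :
  (c \in lower x p) = (c.1 == x) && (p.1 <= c.2 < p.1 + p.2.1.1%:Z).
Proof. exact: mem_run. Qed.

Lemma mem_upper x p c : (c \in upper x p) = (c.1 == x) &&
  (p.1 + (p.2.1.1 + p.2.1.2)%N%:Z <= c.2 < p.1 + (p.2.1.1 + p.2.1.2 + p.2.2)%N%:Z).
Proof. by rewrite mem_run; lia. Qed.

Lemma mem_col x p c : (c \in col x p) = (c.1 == x) &&
  ((p.1 <= c.2 < p.1 + p.2.1.1%:Z) ||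
   (p.1 + (p.2.1.1 + p.2.1.2)%N%:Z <= c.2 < p.1 + (p.2.1.1 + p.2.1.2 + p.2.2)%N%:Z)).
Proof. by rewrite in_fsetU mem_lower mem_upper -andb_orr. Qed.

Lemma card_col x p : #|` col x p| = shape_area p.2.
Proof.
rewrite cardfsU (_ : lower x p `&` upper x p = fset0) ?cardfs0 ?subn0 ?card_run //.
apply/fsetP => c; rewrite in_fsetI mem_lower mem_upper in_fset0.
by lia.
Qed.

Lemma col_bar x a : col x (bar a) = run x 0 a.
Proof. by apply/fsetP => c; rewrite mem_col mem_run /=; lia. Qed.

Lemma linked_run (S : {fset cell}) x y n u v :
  run x y n `<=` S -> u \in run x y n -> v \in run x y n -> linked S u v.
Proof.
move=> nS; move: u v; suff le u v : u \in run x y n -> v \in run x y n -> u.2 <= v.2 -> linked S u v.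
  move=> u v ur vr; have [uv|/ltW vu] := leP u.2 v.2; first exact: le.
  exact/linked_sym/le.
case: u v => [x1 u] [x2 v]; rewrite !mem_run /= => /andP[/eqP-> u_n] /andP[/eqP-> v_n] uv.
apply: (linked_sub nS); apply/linked_column => // [c|z uzv]; rewrite mem_run.
  by case/andP => /eqP.
by rewrite /= eqxx; lia.
Qed.

Lemma lower_base x p : valid_shape p.2 -> (x, p.1) \in lower x p.
Proof. by case: p => y [[a g] b]; rewrite mem_lower /=; lia. Qed.

Lemma upper_base x p : (0 < p.2.2)%N ->
  (x, p.1 + (p.2.1.1 + p.2.1.2)%N%:Z) \in upper x p.
Proof. by case: p => y [[a g] b] /= b0; rewrite mem_upper /= eqxx; lia. Qed.

(** When the upper run is nonempty, the gap has at least one cell, so no adjacency leads out of the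
    lower run. *)
Lemma linked_col x p u v : valid_shape p.2 -> linked (col x p) u v <->
  (u \in lower x p) && (v \in lower x p) || (u \in upper x p) && (v \in upper x p).
Proof.
move=> vp; split=> [uv|/orP[]/andP[]]; last 2 first.
- exact/linked_run/fsubsetUl.
- exact/linked_run/fsubsetUr.
have low s t : linked (col x p) s t -> s \in lower x p -> t \in lower x p.
  move=> st; apply: (linked_closed (a := fun c => c \in lower x p) _ st) => {s t st} s t.
  move: vp; case: p {uv} => y [[a g] b]; rewrite !mem_col !mem_lower adjacentE /=.
  by lia.
have [uS [vS _]] := uv; have vu := low _ _ uv; have := low _ _ (linked_sym uv).
move: uS vS vu; rewrite !in_fsetU.
case: (u \in lower _ _) (v \in lower _ _) => -[] //= uS vS; first by move/(_ isT).
  by move=> _ /(_ isT).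
by rewrite uS vS.
Qed.

Lemma components_col x p C : valid_shape p.2 -> C \in components (col x p) <->
  C = lower x p \/ (0 < p.2.2)%N /\ C = upper x p.
Proof.
move=> vp; rewrite componentsP.
have disj c : c \in lower x p -> c \in upper x p -> False.
  by rewrite mem_lower mem_upper; lia.
split=> [[u]|].
  rewrite in_fsetU => /orP[] uS uC; [left | right].
    apply/fsetP => v; apply/idP/idP.
      by move/uC/(linked_col _ _ _ vp); rewrite uS => /orP[//|/andP[/(disj _ uS)]].
    by move=> vl; apply/uC/linked_col => //; rewrite uS vl.
  split; first by move: uS; rewrite mem_upper; lia.
  apply/fsetP => v; apply/idP/idP.
    by move/uC/(linked_col _ _ _ vp); rewrite uS => /orP[/andP[/disj/(_ uS)]|].
  by move=> vl; apply/uC/linked_col => //; rewrite uS vl orbT.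
case=> [->|[b0 ->]].
  have uS := lower_base x vp.
  exists (x, p.1); first by rewrite in_fsetU uS.
  move=> v; split=> [vl|/(linked_col _ _ _ vp)]; first by apply/linked_col; rewrite ?uS ?vl.
  by rewrite uS => /orP[//|/andP[/(disj _ uS)]].
have uS := upper_base x b0; set w := (x, _) in uS.
exists w; first by rewrite in_fsetU uS orbT.
move=> v; split=> [vl|/(linked_col _ _ _ vp)]; first by apply/linked_col; rewrite ?uS ?vl ?orbT.
by rewrite uS => /orP[/andP[/disj/(_ uS)]|].
Qed.

Lemma components_col_le2 x p : valid_shape p.2 -> (#|` components (col x p)| <= 2)%N.
Proof.
move=> vp; apply: leq_trans (_ : #|` [fset lower x p; upper x p]| <= 2)%N.
  apply/fsubset_leq_card/fsubsetP => C /(components_col _ _ vp); rewrite !inE.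
  by case=> [->|[_ ->]]; rewrite eqxx ?orbT.
by rewrite cardfs2; case: eqP.
Qed.

Lemma col_connected x p : valid_shape p.2 -> is_connected (col x p) = (p.2.2 == 0%N).
Proof.
move=> vp; apply/is_connectedP/eqP => [conn|b0 u v].
  have pl := lower_base x vp.
  case: (posnP p.2.2) => // b0; have wu := upper_base x b0; set w := (x, _) in wu.
  have /(linked_col _ _ _ vp) : linked (col x p) (x, p.1) w.
    by apply: conn; rewrite in_fsetU ?pl ?wu ?orbT.
  by move: vp {conn wu pl}; rewrite !mem_lower !mem_upper /=; case: p @w b0 => y [[a g] b] /=; lia.
rewrite /col (_ : upper x p = fset0) ?fsetU0 => [ul vl|]; first exact: linked_run ul vl.
by apply/fsetP => c; rewrite mem_upper b0 in_fset0; lia.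
Qed.

Lemma col_inj x : {in [pred p | valid_shape p.2] &, injective (col x)}.
Proof.
move=> [y [[a g] b]] [y' [[a' g'] b']]; rewrite !inE /= => v v' E.
have H z : (y <= z < y + a%:Z) || (y + (a + g)%N%:Z <= z < y + (a + g + b)%N%:Z) =
  (y' <= z < y' + a'%:Z) || (y' + (a' + g')%N%:Z <= z < y' + (a' + g' + b')%N%:Z).
  by have := congr1 (fun S : {fset cell} => (x, z) \in S) E; rewrite !mem_col /= eqxx.
have yE : y = y' by have := H y; have := H y'; lia.
subst y'; have aE : a = a' by have := H (y + a%:Z); have := H (y + a'%:Z); lia.
subst a'; have bE : (b == 0%N) = (b' == 0%N).
  by have := H (y + (a + g)%N%:Z); have := H (y + (a + g')%N%:Z); lia.
have gE : g = g'.
  by have := H (y + (a + g)%N%:Z); have := H (y + (a + g')%N%:Z); lia.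
subst g'; have -> : b = b'; last by [].
by have := H (y + (a + g + b)%N%:Z); have := H (y + (a + g + b')%N%:Z); lia.
Qed.

End Columns.

(** * Column sequences yield cheesy polyominoes *)

Section Cells.
Local Open Scope classical_set_scope.
Local Open Scope fset_scope.
Local Open Scope ring_scope.

Fixpoint cells (x : int) (c : seq column_code) : {fset cell} :=
  if c is p :: c' then col x p `|` cells (x + 1) c' else fset0.

Lemma cells_ge x c u : u \in cells x c -> x <= u.1.
Proof.
elim: c x => //= p c IH x; rewrite in_fsetU mem_col => /orP[/andP[/eqP-> _] //|/IH].
by lia.
Qed.

Lemma card_cells x c : #|` cells x c| = code_area c.
Proof.
elim: c x => [|p c IH] x; first by rewrite cardfs0.
rewrite [cells _ _]/= cardfsU (_ : _ `&` _ = fset0) ?cardfs0 ?subn0 ?card_col ?IH //.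
apply/fsetP => u; rewrite in_fsetI in_fset0; apply/negbTE/negP => /andP[].
by rewrite mem_col => /andP[/eqP ux _] /cells_ge; lia.
Qed.

Lemma mem_column P x u : (u \in column P x) = (u \in P) && (u.1 == x).
Proof. by rewrite !inE. Qed.

Lemma column_cells x c (i : nat) : (i < size c)%N ->
  column (cells x c) (x + i%:Z) = col (x + i%:Z) (nth (bar 0) c i).
Proof.
elim: c x i => // p c IH x [|i] /= ic; apply/fsetP => u.
  rewrite addr0 mem_column in_fsetU; case: (u.1 =P x) => ux.
    by rewrite andbT orb_idr // => /cells_ge; lia.
  by rewrite andbF mem_col (introF eqP ux).
have -> : x + i.+1%:Z = x + 1 + i%:Z by lia.
rewrite -IH // !mem_column in_fsetU mem_col.
case: (u.1 =P x + 1 + i%:Z) => ux; rewrite ?andbF // !andbT.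
by rewrite [u.1 == x](_ : _ = false) //; lia.
Qed.

Lemma column_cells_empty x c z : (z < x) || (x + (size c)%:Z <= z) ->
  column (cells x c) z = fset0.
Proof.
move=> zx; apply/fsetP => u; rewrite mem_column in_fset0.
elim: c x zx => [|p c IH] x zx; first by rewrite in_fset0.
rewrite [cells _ _]/= in_fsetU andb_orl IH; last by move: zx => /=; lia.
by rewrite orbF mem_col; apply/negbTE; move: zx => /=; lia.
Qed.

Lemma run_touchesP x p y n : (0 < n)%N -> valid_shape p.2 ->
  run_touches p y n <-> shares_edge (run (x + 1) y n) (col x p).
Proof.
case: p => z [[a g] b] n0 /= /andP[a0 _]; split; last first.
  move=> [[x1 u] [[x2 v] []]]; rewrite mem_run mem_col adjacentE /=; lia.
(* The witnesses are at equal heights, y if l <= y and l if y < l < y + n; when l = y + n, the top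
   cell y + n - 1 uses its other left edge. *)
have touch l m : (0 < m)%N -> y < l + m%:Z -> l - 1 < y + n%:Z ->
    (forall v, l <= v < l + m%:Z -> (x, v) \in col x (z, (a, g, b))) ->
    shares_edge (run (x + 1) y n) (col x (z, (a, g, b))).
  move=> m0 ylm lyn colv; have [ly|yl] := leP l y.
    exists (x + 1, y), (x, y); rewrite mem_run adjacentE colv /=; last by lia.
    by split=> //; lia.
  have [lyn'|lyn'] := ltP l (y + n%:Z).
    exists (x + 1, l), (x, l); rewrite mem_run adjacentE colv /=; last by lia.
    by split=> //; lia.
  exists (x + 1, l - 1), (x, l); rewrite mem_run adjacentE colv /=; last by lia.
  by split=> //; lia.
case/orP => [/andP[h1 h2]|/and3P[b0 h1 h2]].
  by apply: (touch z a) => // v zv; rewrite mem_col /= eqxx zv.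
apply: (touch (z + (a + g)%N%:Z) b) => //; first by lia.
by move=> v zv; rewrite mem_col /= eqxx; lia.
Qed.

Lemma touchesP x p r : valid_shape p.2 -> valid_shape r.2 ->
  touches p r <-> forall C, C \in components (col (x + 1) r) -> shares_edge C (col x p).
Proof.
move=> vp vr; have r0 : (0 < r.2.1.1)%N by case: r vr => y [[c h] d] /andP[].
have -> : touches p r = run_touches p r.1 r.2.1.1 &&
    ((r.2.2 == 0%N) || run_touches p (r.1 + (r.2.1.1 + r.2.1.2)%N%:Z) r.2.2).
  by case: r {vr r0} => y [[c h] d].
split=> [/andP[low up] C /(components_col _ _ vr)[->|[d0 ->]]|comp].
- exact/run_touchesP.
- by apply/run_touchesP => //; move: up; rewrite eqn0Ngt d0.
apply/andP; split.
  by apply/(run_touchesP x) => //; apply/comp/components_col => //; left.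
have [//|d0] := posnP; apply/(run_touchesP x) => //.
by apply/comp/components_col => //; right.
Qed.

Lemma path_step_valid p c : valid_shape p.2 -> path step p c ->
  all (fun r => valid_shape r.2) (p :: c).
Proof.
elim: c p => [|r c IH] p /= vp; first by rewrite vp.
by case/andP => /andP[_ vr] /(IH _ vr) /= ->; rewrite vp.
Qed.

(** Every component of a column shares an edge with the column on its left, so each cell is led
    leftwards, column by column. *)
Lemma cells_linked_first x p c u : valid_shape p.2 -> path step p c ->
  u \in cells x (p :: c) -> exists2 v, v \in col x p & linked (cells x (p :: c)) u v.
Proof.
elim: c x p u => [|r c IH] x p u vp.
  by move=> _ uS; exists u; [move: uS; rewrite /= fsetU0 | apply: linked_refl].
move=> /andP[/andP[tpr vr] pc]; rewrite [cells _ _]/= in_fsetU => /orP[uS|/(IH _ _ _ vr pc)[v vS uv]].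
  by exists u => //; apply/linked_refl; rewrite in_fsetU uS.
have edge C : C \in components (col (x + 1) r) -> shares_edge C (col x p).
  exact: (touchesP x vp vr).1 tpr C.
have {uv} uv : linked (cells x [:: p, r & c]) u v by apply: linked_sub uv; apply: fsubsetUr.
have sub_run C : C `<=` col (x + 1) r -> C `<=` cells x [:: p, r & c].
  move=> Cr; apply: fsubset_trans Cr _.
  by apply: fsubset_trans (fsubsetUr _ _); apply: fsubsetUl.
have [C CS [vC Clk]] : exists2 C, C \in components (col (x + 1) r) &
    v \in C /\ {in C &, forall s t, linked (cells x [:: p, r & c]) s t}.
  move: vS; rewrite in_fsetU => /orP[] vS; [exists (lower (x + 1) r) | exists (upper (x + 1) r)].
  - by apply/components_col => //; left.
  - by split=> // s t; apply/linked_run/sub_run/fsubsetUl.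
  - by apply/components_col => //; right; split=> //; move: vS; rewrite mem_upper; lia.
  - by split=> // s t; apply/linked_run/sub_run/fsubsetUr.
have [e [d [eC dS ed]]] := edge C CS.
exists d => //; apply: linked_trans uv _; apply: linked_trans (Clk v e vC eC) _.
have [_ [eS _]] := Clk v e vC eC.
by apply: linked_adjacent => //; rewrite in_fsetU dS.
Qed.

Lemma gap_run x y (a g b : nat) : (0 < a)%N -> (0 < b)%N ->
  gap x (run x y a) (run x (y + (a + g)%N%:Z) b) =
  [set (x, y + a%:Z + i%:Z) | i in `I_g].
Proof.
move=> a0 b0; apply/seteqP; split=> [[x' z] [/= -> low up]|_ [i /= ig <-]].
  have /= h1 := low (x, y + a%:Z - 1); have /= h2 := up (x, y + (a + g)%N%:Z).
  rewrite !mem_run /= eqxx in h1 h2.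
  have {}h1 : y + a%:Z - 1 < z by apply: h1; lia.
  have {}h2 : z < y + (a + g)%N%:Z by apply: h2; lia.
  exists (absz (z - (y + a%:Z)%R)%R) => /=; first by lia.
  by congr (_, _); lia.
by split=> //= [c|d]; rewrite mem_run => /andP[_] cd; move: ig cd => /=; lia.
Qed.

Lemma gap_run_rev x y (a g b : nat) : (0 < a)%N -> (0 < b)%N ->
  gap x (run x (y + (a + g)%N%:Z) b) (run x y a) = set0.
Proof.
move=> a0 b0; apply/seteqP; split=> // -[x' z] [/= _ low up].
have /= h2 := up (x, y); have /= h1 := low (x, y + (a + g)%N%:Z).
rewrite !mem_run /= eqxx in h1 h2.
have {}h1 : y + (a + g)%N%:Z < z by apply: h1; lia.
have {}h2 : z < y by apply: h2; lia.
lia.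
Qed.

Lemma card_gap_run x y (a g b m : nat) : (0 < a)%N -> (0 < b)%N ->
  (gap x (run x y a) (run x (y + (a + g)%N%:Z) b) #<= `I_m)%card = (g <= m)%N.
Proof.
move=> a0 b0; rewrite gap_run // -card_le_II; apply: card_le_eql.
by apply: inj_card_eq => i j _ _ [] /addrI [].
Qed.

Lemma cheesy_cells c : is_code c -> cheesy 3 (cells 0 c).
Proof.
case: c => // p c /and3P[a0 /eqP pE pc].
have vp : valid_shape p.2 by rewrite pE /= a0.
have col0 : col 0 p = run 0 0 p.2.1.1 by rewrite pE col_bar.
have valid_nth i : (i < size (p :: c))%N -> valid_shape (nth (bar 0) (p :: c) i).2.
  by have /(all_nthP (bar 0)) := path_step_valid vp pc; apply.
have colP x : column (cells 0 (p :: c)) x != fset0 ->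
    exists2 i : nat, (i < size (p :: c))%N & x = i%:Z.
  have [xlt|xge] := boolP ((x < 0) || (0 + (size (p :: c))%:Z <= x)).
    by rewrite column_cells_empty ?eqxx.
  by exists (absz x); lia.
have colE i : (i < size (p :: c))%N ->
    column (cells 0 (p :: c)) i%:Z = col i%:Z (nth (bar 0) (p :: c) i).
  by move=> ic; rewrite -(add0r i%:Z) column_cells.
have comp_empty : components (fset0 : {fset cell}) = fset0.
  by apply/fsetP => C; rewrite in_fset0; apply/negbTE/negP => /componentsP[u].
split.
- split.
    by apply/fset0Pn; exists (0, p.1); rewrite in_fsetU in_fsetU lower_base.
  apply/is_connectedP => u v /cells_linked_first [] // u' u'S uu'.
  move=> /cells_linked_first [] // v' v'S vv'.
  apply: linked_trans uu' _; apply: linked_trans (linked_sym vv').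
  by move: u'S v'S; rewrite col0 => u'S v'S; apply: linked_run u'S v'S; rewrite -col0 fsubsetUl.
- split=> [x [/colP[i ic ->] min_i]|x x' [xx' /colP[i ic xE] /colP[j jc x'E] between] C].
    case: i ic min_i => [|i] ic min_i; last first.
      have /fsetP/(_ (0, p.1)) := min_i 0 isT.
      by rewrite mem_column in_fset0 /= in_fsetU in_fsetU lower_base.
    by rewrite colE // col_connected // [nth _ _ _]pE.
  (* A code has no empty column, so adjacent columns have consecutive abscissas. *)
  subst x x'; have jE : j = i.+1.
    apply/eqP; rewrite eqn_leq; apply/andP; split; last by lia.
    rewrite leqNgt; apply/negP => ij; have ic' := ltn_trans ij jc.
    have /fsetP/(_ (i.+1%:Z, (nth (bar 0) (p :: c) i.+1).1)) : column (cells 0 (p :: c)) i.+1%:Z = fset0.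
      by apply: between; lia.
    by rewrite colE // in_fset0 in_fsetU lower_base ?valid_nth.
  subst j; rewrite !colE // (_ : i.+1%:Z = i%:Z + 1); last by lia.
  have /andP[tch _] : step (nth (bar 0) (p :: c) i) (nth (bar 0) (p :: c) i.+1).
    by apply: (pathP (bar 0) pc).
  by apply: (touchesP _ (valid_nth i ic) (valid_nth _ jc)).1.
- move=> x; have [->|/colP[i ic ->]] := eqVneq (column (cells 0 (p :: c)) x) fset0.
    by rewrite comp_empty cardfs0.
  by rewrite colE // components_col_le2 ?valid_nth.
move=> x C D; have [->|/colP[i ic ->]] := eqVneq (column (cells 0 (p :: c)) x) fset0.
  by rewrite comp_empty in_fset0.
rewrite colE //; set r := nth _ _ _; have vr : valid_shape r.2 := valid_nth i ic.
move=> /(components_col _ _ vr) CE /(components_col _ _ vr) DE CD.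
have a1 : (0 < r.2.1.1)%N by move: vr {CE DE}; case: r => y [[a g] b] /andP[].
have g3 : (r.2.1.2 <= 3)%N by move: vr {CE DE a1}; case: r => y [[a g] b] /=; lia.
case: CE DE CD => [->|[b0 ->]] [->|[b0' ->]]; rewrite ?eqxx // => _.
  by rewrite card_gap_run.
by rewrite /lower /upper gap_run_rev // card_ge0.
Qed.

End Cells.

(** * Uniqueness of the code of a translation class *)

Section Encoding.
Local Open Scope classical_set_scope.
Local Open Scope fset_scope.
Local Open Scope ring_scope.

Lemma mem_translate v P u : (u \in translate v P) = (u - v \in P).
Proof.
apply/imfsetP/idP => [[w /= wP ->]|uP]; first by rewrite addrK.
by exists (u - v); rewrite ?subrK.
Qed.

Lemma translate0 P : translate 0 P = P.
Proof. by apply/fsetP => u; rewrite mem_translate subr0. Qed.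

Lemma card_translate v P : #|` translate v P| = #|` P|.
Proof. by rewrite card_imfset //; apply: addIr. Qed.

Lemma cells_inj x c c' : all (fun r => valid_shape r.2) c ->
  all (fun r => valid_shape r.2) c' -> cells x c = cells x c' -> c = c'.
Proof.
elim: c c' x => [|p c IH] [|p' c'] x //=.
- move=> _ /andP[vp _] /fsetP/(_ (x, p'.1)).
  by rewrite in_fset0 !in_fsetU lower_base.
- move=> /andP[vp _] _ /fsetP/(_ (x, p.1)).
  by rewrite in_fset0 !in_fsetU lower_base.
move=> /andP[vp vc] /andP[vp' vc'] E.
have colE : col x p = col x p'.
  have := congr1 (column^~ x) E.
  rewrite -[_ `|` _]/(cells x (p :: c)) -[col x p' `|` _]/(cells x (p' :: c')).
  by have := @column_cells x (p :: c) 0 isT; have := @column_cells x (p' :: c') 0 isT;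
    rewrite addr0 /= => -> ->.
congr (_ :: _); first exact: col_inj colE.
apply: (IH _ (x + 1)) => //.
(* The tail is recovered as the part strictly to the right of x. *)
have tailE r s u : (u \in cells (x + 1) s) = (u \in col x r `|` cells (x + 1) s) && (x < u.1).
  rewrite in_fsetU; apply/idP/idP => [us|].
    by rewrite us orbT /= -lezD1 (cells_ge us).
  by rewrite mem_col => /andP[/orP[/andP[/eqP-> _]|//]]; rewrite ltxx.
by apply/fsetP => u; rewrite (tailE p) (tailE p') E.
Qed.

Lemma is_code_valid c : is_code c -> all (fun r => valid_shape r.2) c.
Proof.
case: c => // p c /and3P[a0 /eqP pE]; apply: path_step_valid.
by rewrite pE /= a0.
Qed.

Lemma mem_cells_origin c : is_code c -> (0, 0) \in cells 0 c.
Proof.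
case: c => // -[y [[a g] b]] c /and3P[/= a0 /eqP[-> -> ->] _].
by rewrite in_fsetU in_fsetU mem_lower /=; lia.
Qed.

Lemma cells_origin_min c u : is_code c -> u \in cells 0 c ->
  0 <= u.1 /\ (u.1 = 0 -> 0 <= u.2).
Proof.
case: c => // p c /and3P[a0 /eqP pE _] uS; split; first exact: cells_ge uS.
move: uS; rewrite in_fsetU => /orP[|/cells_ge]; last by lia.
by rewrite pE col_bar mem_run => /andP[_ /andP[]].
Qed.

(** The origin is the lexicographically least cell of a coded polyomino. Both v and - v are cells of
    such polyominoes, so v = 0. *)
Lemma translate_cells_inj v c c' : is_code c -> is_code c' ->
  translate v (cells 0 c) = cells 0 c' -> c = c'.
Proof.
move=> codec codec' E.
have := mem_cells_origin codec'; rewrite -E mem_translate.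
move=> /(cells_origin_min codec) /=; rewrite !sub0r => -[h1 h2].
have : v \in cells 0 c' by rewrite -E mem_translate subrr mem_cells_origin.
move=> /(cells_origin_min codec') [h3 h4].
have v0 : v = 0.
  have v1 : v.1 = 0 by move: h1 h3 => /=; lia.
  case: v v1 {E} h1 h2 h3 h4 => v1 v2 /= -> _ h2 _ h4.
  by congr (_, _); move: (h2 (oppr0 _)) (h4 erefl); lia.
by move: E; rewrite v0 translate0; apply: cells_inj; apply: is_code_valid.
Qed.

Lemma translation_class_cells_inj :
  {in is_code &, injective (fun c => translation_class (cells 0 c))}.
Proof.
move=> c c' codec codec' E.
have : translation_class (cells 0 c) (cells 0 c').
  by rewrite E; exists 0; rewrite ?translate0.
by case=> v _; apply: translate_cells_inj.
Qed.

Definition shift_code (z : int) (c : seq column_code) : seq column_code :=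
  [seq (r.1 + z, r.2) | r <- c].

Lemma shift_codeK z c : shift_code z (shift_code (- z) c) = c.
Proof. by rewrite /shift_code -map_comp map_id_in // => -[y s] _ /=; rewrite subrK. Qed.

Lemma translate_cells v x c :
  translate v (cells x c) = cells (x + v.1) (shift_code v.2 c).
Proof.
elim: c x => [|p c IH] x; apply/fsetP => u.
  by rewrite mem_translate !in_fset0.
rewrite [shift_code _ _]/= [cells _ _]/= [in RHS]/= addrAC -IH in_fsetU !mem_translate in_fsetU.
congr orb; rewrite !mem_col -[(u - v).1]/(u.1 - v.1) -[(u - v).2]/(u.2 - v.2) /=.
by lia.
Qed.

Lemma step_shift z p r : step (p.1 + z, p.2) (r.1 + z, r.2) = step p r.
Proof.
case: p r => y [[a g] b] [y' [[c h] d]]; rewrite /step /touches /run_touches /=.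
by congr (_ && _); lia.
Qed.

Lemma path_shift z p c : path step (p.1 + z, p.2) (shift_code z c) = path step p c.
Proof. by elim: c p => //= r c IH p; rewrite step_shift IH. Qed.

Lemma fset_argmin (S : {fset cell}) (f : cell -> int) : S != fset0 ->
  exists2 u, u \in S & {in S, forall v, f u <= f v}.
Proof.
case/fset0Pn => u0 u0S; pose i0 := [` u0S].
case: (@Order.TotalTheory.arg_minP _ _ _ i0 xpredT (fun i : S => f (val i)) isT) => i _ imin.
exists (val i); first exact: valP.
by move=> v vS; apply: (imin [` vS]).
Qed.

End Encoding.

(** * Every cheesy polyomino comes from a column sequence *)

Section Decoding.
Local Open Scope classical_set_scope.
Local Open Scope fset_scope.
Local Open Scope ring_scope.

Lemma run_end (S : {fset cell}) (x y : int) : exists n : nat,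
  (forall z : int, y <= z < y + n%:Z -> (x, z) \in S) /\ (x, y + n%:Z) \notin S.
Proof.
have exn : exists n : nat, (x, y + n%:Z) \notin S.
  have [->|S0] := eqVneq S fset0; first by exists 0%N; rewrite in_fset0.
  have [u _ umin] := fset_argmin (fun c => - c.2) S0.
  exists (absz (u.2 - y) + 1)%N; apply/negP => /umin /=; lia.
case: (ex_minnP exn) => n yn nmin; exists n; split=> // z zn.
apply: contraT => zS; have := nmin (absz (z - y)).
by rewrite gez0_abs ?subrKC //; last lia; move=> /(_ zS); lia.
Qed.

Lemma components_of (S : {fset cell}) u : u \in S ->
  exists2 C, C \in components S & forall v, v \in C <-> linked S u v.
Proof.
move=> uS; have CS : component [` uS] \in components S by apply/imfsetP; exists [` uS].
have /componentsP[w wS wC] := CS; exists (component [` uS]) => // v.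
have uC : u \in component [` uS] by apply/imfsetP; exists [` uS] => //; apply: connect0.
have wu := (wC u).1 uC; rewrite wC; split; first exact/linked_trans/linked_sym.
exact: linked_trans.
Qed.

Lemma components_gt2 (S : {fset cell}) u v w :
  u \in S -> v \in S -> w \in S ->
  ~ linked S u v -> ~ linked S u w -> ~ linked S v w -> (2 < #|` components S|)%N.
Proof.
move=> uS vS wS uv uw vw.
have [C CS uC] := components_of uS; have [D DS vD] := components_of vS.
have [E ES wE] := components_of wS.
have neq s t (X Y : {fset cell}) : t \in S -> ~ linked S s t ->
    (forall z, z \in X <-> linked S s z) -> (forall z, z \in Y <-> linked S t z) -> X != Y.
  move=> tS st sX tY; apply/eqP => XY; apply: st.
  by apply/sX; rewrite XY; apply/tY/linked_refl.
have sub : [fset C; D; E] `<=` components S.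
  by apply/fsubsetP => X; rewrite !inE -orbA => /or3P[]/eqP->.
apply: leq_trans (fsubset_leq_card sub).
rewrite -fsetUA cardfsU1 cardfs2 !inE negb_or.
by rewrite (neq u v) // (neq u w) // (neq v w).
Qed.

(** The lower run starts at the lowest cell, and the upper one at the lowest cell beyond the end of
    the lower run. *)
Lemma column_decode (S : {fset cell}) (x : int) :
  S != fset0 -> {in S, forall c, c.1 = x} -> (#|` components S| <= 2)%N ->
  (forall C D, C \in components S -> D \in components S -> C != D ->
    (gap x C D #<= `I_3)%card) ->
  exists2 p, valid_shape p.2 & S = col x p.
Proof.
move=> S0 Sx comp2 gap3.
have inS (u : cell) : u \in S -> u = (x, u.2) by move=> uS; rewrite -(Sx u uS); case: u {uS}.
have nlinked (y z y' : int) : y <= z -> z <= y' -> (x, z) \notin S -> ~ linked S (x, y) (x, y').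
  move=> yz zy' zS /(linked_column Sx (le_trans yz zy')) H.
  by move/negP: zS; apply; apply: H; rewrite yz.
have [[x0 l] lS lmin] := fset_argmin snd S0.
have /= x0E := Sx _ lS; subst x0; rewrite /= in lmin.
have [a [aS aN]] := run_end S x l.
have a0 : (0 < a)%N by case: a {aS} aN => //; rewrite addr0 lS.
pose S1 := [fset c in S | l + a%:Z < c.2].
have mem1 c : (c \in S1) = (c \in S) && (l + a%:Z < c.2) by rewrite !inE.
have split1 (c : cell) : c \in S -> (l <= c.2 < l + a%:Z) || (c \in S1).
  move=> cS; rewrite mem1 cS (lmin _ cS) /=.
  have : c.2 != l + a%:Z by apply: contraNneq aN => <-; rewrite -inS.
  by case: ltgtP.
clearbody S1; have [S10|S10] := eqVneq S1 fset0.
  exists (l, (a, 0, 0)%N); first by rewrite /= a0.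
  apply/fsetP => c; rewrite mem_col /=; apply/idP/idP => [cS|].
    by rewrite (Sx _ cS) eqxx; have := split1 c cS; rewrite S10 in_fset0 orbF => ->.
  case: c => x' z /= /andP[/eqP-> ] /orP[|]; first exact: aS.
  by lia.
have [[x1 m] mS1 mmin] := fset_argmin snd S10; rewrite /= in mmin.
have [mS lam] : (x, m) \in S /\ l + a%:Z < m.
  by move: mS1; rewrite mem1 => /andP[mS ->]; have /= <- := Sx _ mS.
have [b [bS bN]] := run_end S x m.
have b0 : (0 < b)%N by case: b {bS} bN => //; rewrite addr0 mS.
pose g := absz (m - (l + a%:Z))%R.
have mE : m = l + (a + g)%N%:Z by rewrite /g; clear -lam; lia.
clearbody g.
have alink (z : int) : l + a%:Z <= z -> ~ linked S (x, l) (x, z).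
  by move=> az; apply: (nlinked l (l + a%:Z)) => //; lia.
(* A cell above the second run would belong to a third component. *)
have S2 (c : cell) : c \in S -> c.2 < m + b%:Z.
  move=> cS; rewrite ltNge; apply/negP => bc; move: comp2; rewrite leqNgt => /negP; apply.
  have cS' : (x, c.2) \in S by rewrite -inS.
  apply: (components_gt2 lS mS cS').
  - by apply: alink; clear -lam; lia.
  - by apply: alink; clear -lam bc; lia.
  by apply: (nlinked m (m + b%:Z)) => //; clear -bc; lia.
have [C CS lC] := components_of lS; have [D DS mD] := components_of mS.
(* The g cells between the runs lie in the gap of the components, which bounds g by 3. *)
have gapE : ([set ((x, l + a%:Z + i%:Z) : cell) | i in `I_g] `<=` gap x C D)%classic.
  move=> _ [i /= ig <-]; split=> //= [c /lC lc|d /mD md].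
    have [_ [cS _]] := lc; rewrite ltNge; apply/negP => ic; apply: (alink c.2); first by clear -ic; lia.
    by rewrite -inS.
  have [_ [dS _]] := md; rewrite ltNge; apply/negP => id.
  case/orP: (split1 d dS) => [/andP[_ da]|/mmin]; last by clear -id mE ig; lia.
  apply: (nlinked d.2 (l + a%:Z) m) => //; try by [clear -da; lia | clear -lam; lia].
  by rewrite -inS //; apply: linked_sym.
have g3 : (g <= 3)%N.
  rewrite -card_le_II; apply: card_le_trans (gap3 C D CS DS _).
    apply: card_le_trans (subset_card_le gapE).
    have imE : ([set ((x, l + a%:Z + i%:Z) : cell) | i in `I_g] #= `I_g)%card.
      by apply: inj_card_eq => i j _ _ [] /addrI [].
    by rewrite (card_le_eqr imE) card_lexx.
  apply/eqP => CD; apply: (alink m); first exact: ltW.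
  by apply/lC; rewrite CD; apply/mD/linked_refl.
exists (l, (a, g, b)); first by rewrite /= a0 b0 g3; clear -lam mE; lia.
apply/fsetP => c; rewrite mem_col /=; apply/idP/idP => [cS|].
  rewrite (Sx _ cS) eqxx /=; case/orP: (split1 c cS) => [->//|/mmin mc].
  by have := S2 c cS; clear -mc mE; lia.
case: c => x' z /= /andP[/eqP-> ] /orP[|]; first exact: aS.
by move=> zb; apply: bS; clear -zb mE; lia.
Qed.

Lemma cheesy_column P x : cheesy 3 P -> column P x != fset0 ->
  exists2 p, valid_shape p.2 & column P x = col x p.
Proof.
move=> [_ _ comp2 gap3] P0; apply: column_decode => //.
- by move=> c; rewrite mem_column => /andP[_ /eqP].
- by move=> C D; apply: gap3.
Qed.

(** Induction on a bound n for the extent of P to the right of x. *)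
Lemma cells_right P x p : cheesy 3 P -> valid_shape p.2 -> column P x = col x p ->
  exists2 c, path step p c &
    forall u, (u \in cells x (p :: c)) = (u \in P) && (x <= u.1).
Proof.
move=> cheP.
have [polyP [_ right] _ _] := cheP; have [P0 /is_connectedP conP] := polyP.
have [n nP] : exists n : nat, {in P, forall u, u.1 < x + n%:Z}.
  have [w _ wmax] := fset_argmin (fun c => - c.1) P0.
  by exists (absz (w.1 - x) + 1)%N => u /wmax /=; lia.
elim: n x p nP => [|n IH] x p nP vp colx.
  have : (x, p.1) \in column P x by rewrite colx in_fsetU lower_base.
  by rewrite mem_column => /andP[/nP /=]; lia.
have pP : (x, p.1) \in P.
  have : (x, p.1) \in column P x by rewrite colx in_fsetU lower_base.
  by rewrite mem_column => /andP[].
have memx u : (u \in col x p) = (u \in P) && (u.1 == x) by rewrite -colx mem_column.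
have [col0|col1] := eqVneq (column P (x + 1)) fset0.
  exists [::] => // u; rewrite /= fsetU0 memx.
  have [uP|//] := boolP (u \in P).
  suff : u.1 <= x by move=> /=; lia.
  (* A path starting in column x cannot jump over the empty column x + 1. *)
  apply: (linked_closed (a := fun v => v.1 <= x) _ (conP _ _ pP uP)) => //= s t _ tP.
  have : t.1 != x + 1.
    apply/eqP => tx; have : t \in column P (x + 1) by rewrite mem_column tP tx eqxx.
    by rewrite col0 in_fset0.
  by rewrite adjacentE; lia.
have [r vr colr] := cheesy_column cheP col1.
have tpr : touches p r.
  apply/(touchesP x vp vr); rewrite -colx -colr; apply: right; split=> //.
  - by lia.
  - by apply/fset0Pn; exists (x, p.1); rewrite mem_column pP eqxx.
  - by move=> z; lia.
have [u uP|c pc cE] := IH (x + 1) r _ vr colr; first by have := nP u uP; lia.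
exists (r :: c); first by rewrite /= /step tpr vr.
move=> u; rewrite in_fsetU cE memx -andb_orr; congr andb; lia.
Qed.

(** The leftmost column is connected, hence a single run; translating its lowest cell to the origin
    normalises the code. *)
Lemma cheesy_decode P : cheesy 3 P ->
  exists2 c, is_code c & exists v, P = translate v (cells 0 c).
Proof.
move=> cheP; have [[P0 _] [first _] _ _] := cheP.
have [u uP umin] := fset_argmin fst P0.
have fstu : first_column P u.1.
  split; first by apply/fset0Pn; exists u; rewrite mem_column uP eqxx.
  move=> z zu; apply/fsetP => v; rewrite mem_column in_fset0; apply/negbTE/negP.
  by case/andP => /umin /= uv /eqP vz; move: zu; rewrite -vz ltNge uv.
have [[y [[a g] b]] vp colu] := cheesy_column cheP fstu.1.
have := first _ fstu; rewrite colu col_connected // => /eqP /= b0; subst b.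
have g0 : g = 0%N by move: vp => /=; lia.
subst g; have [c pc cE] := cells_right cheP vp colu.
exists (shift_code (- y) ((y, (a, 0, 0)%N) :: c)).
  rewrite /is_code /= subrr eqxx; apply/and3P; split=> //; first by move: vp => /andP[].
  by have := path_shift (- y) (y, (a, 0, 0)%N) c; rewrite /= subrr pc.
exists (u.1, y); rewrite translate_cells add0r (shift_codeK y).
apply/fsetP => v.
by rewrite cE; apply/esym/andb_idr => /umin.
Qed.

End Decoding.

(** * Translation classes counted by codes *)

Section Counting.
Local Open Scope classical_set_scope.
Local Open Scope fset_scope.
Local Open Scope ring_scope.

Lemma cheesy_classesE M n : (n <= M)%N -> cheesy_classes 3 n =
  ((fun c => translation_class (cells 0 c)) @`
    [set` [fset c in [seq c <- codes M | code_area c == n]]%fset])%classic.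
Proof.
move=> nM; apply/seteqP; split=> X.
  move=> [P [cheP cardP] <-]; have [c codec [v PE]] := cheesy_decode cheP.
  exists c; last by rewrite PE translation_class_translate.
  have cn : code_area c = n by rewrite -cardP PE card_translate card_cells.
  by rewrite /= in_fset /= mem_filter mem_codes cn ?eqxx.
move=> [c] /=; rewrite in_fset /= mem_filter => /andP[/eqP cn cM] <-.
rewrite mem_codes ?cn // in cM.
exists (cells 0 c) => //; split; first exact: cheesy_cells.
by rewrite card_cells.
Qed.

Lemma cheesy_gfE M n : (n <= M)%N ->
  cheesy_gf 3 n = (\sum_(c <- codes M) 'X^(code_area c) : {poly int})`_n.
Proof.
move=> nM; rewrite coef_sum_Xn /cheesy_gf (cheesy_classesE nM); congr Posz.
rewrite fset_set_image; last exact: finite_fset.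
rewrite set_fsetK card_in_imfset => [|c c'] /=.
  by rewrite card_fseq undup_id ?filter_uniq ?codes_uniq ?size_filter.
rewrite !in_fset /= !mem_filter => /andP[/eqP cn cM] /andP[/eqP cn' cM'].
by rewrite !mem_codes ?cn ?cn' // in cM cM'; apply: translation_class_cells_inj.
Qed.

End Counting.

Theorem proposition4 :
  fps_mul (fps_of_poly cheesy3_den) (cheesy_gf 3) = fps_of_poly cheesy3_num.
Proof.
apply/funext => n; rewrite /fps_of_poly -coef_den_codes coefM /fps_mul.
(* The single truncation [codes n.+2] serves all coefficients n - i of the convolution. *)
apply: eq_bigr => i _; congr (_ * _)%R; apply: cheesy_gfE.
by rewrite (leq_trans (leq_subr _ _)) // -addn2 leq_addr.
Qed.
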